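(* Let $\omega_0$ and $\omega_1$ be two principal connection forms on the $\mathfrak g$-manifold $M$ with curvature forms $\Omega_0,\Omega_1\in\Omega^2(M;\mathfrak g)^{\mathfrak g}$, and let $f\in L^k(\mathfrak g)^{\mathfrak g}$. Then the cohomology classes of the two closed forms $f^{\Omega_0}$ and $f^{\Omega_1}$ in the de Rham cohomology $H^{2k}(M)$ coincide. If $M$ is a free $\mathfrak g$-manifold, then the curvature forms $\Omega_0,\Omega_1$ are horizontal, and $f^{\Omega_0}$ and $f^{\Omega_1}$ define the same basic cohomology class in $H^{2k}_{\mathfrak g}(M)=H^{2k}(\Omega^*_{\mathrm{hor}}(M)^{\mathfrak g},d)$.
   Context: $\mathfrak g$ is a finite-dimensional real Lie algebra. A $\mathfrak g$-manifold is a smooth manifold $M$ with a Lie algebra homomorphism $\zeta:\mathfrak g\to\mathfrak X(M)$; it is free if $X\mapsto\zeta_X(x)$ is injective for each $x\in M$. Put $\zeta_x:\mathfrak g\to T_xM$, $X\mapsto\zeta_X(x)$. A principal connection form is $\omega\in\Omega^1(M;\mathfrak g)$ with $\mathcal L_{\zeta_X}\omega=-\operatorname{ad}(X)\circ\omega$ for all $X\in\mathfrak g$ and $\zeta_x\circ\omega_x\circ\zeta_x=\zeta_x$ for all $x\in M$. Its curvature form is $\Omega=d\omega+\tfrac12[\omega,\omega]^\wedge$, where $\tfrac12[\omega,\omega]^\wedge(\xi,\eta)=[\omega(\xi),\omega(\eta)]$. $\Omega^p(M;\mathfrak g)^{\mathfrak g}$ denotes forms $\psi$ with $\mathcal L_{\zeta_X}\psi=-\operatorname{ad}(X)\circ\psi$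 for all $X$. A form is horizontal if it is killed by $i_{\zeta_X}$ for all $X\in\mathfrak g$. $\Omega^p_{\mathrm{hor}}(M)^{\mathfrak g}$ is the space of basic forms: real-valued horizontal forms $\varphi$ with $\mathcal L_{\zeta_X}\varphi=0$ for all $X$; $d$ preserves basic forms, and the cohomology of this complex is the basic cohomology $H^*_{\mathfrak g}(M)$. $L^k(\mathfrak g)^{\mathfrak g}$ is the space of $k$-linear functions $f:\mathfrak g^k\to\mathbb R$ with $\sum_{i=1}^kf(Y_1,\dots,[X,Y_i],\dots,Y_k)=0$ for all $X,Y_j\in\mathfrak g$. For such $f$, $f^\Omega:=f\circ(\Omega\otimes_\wedge\dots\otimes_\wedge\Omega)\in\Omega^{2k}(M)$ is obtained by applying $f$ to the $\mathfrak g^{\otimes k}$-valued $2k$-form given by the iterated product $(\Phi\otimes_\wedge\Psi)(\xi_1,\dots,\xi_{p+q})=\frac1{p!q!}\sum_\sigma\operatorname{sign}(\sigma)\,\Phi(\xi_{\sigma1},\dots,\xi_{\sigma p})\otimes\Psi(\xi_{\sigma(p+1)},\dots,\xi_{\sigma(p+q)})$ for $\Phi$ of degree $p$ and $\Psi$ of degree $q$. *)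

(* Defs.v *)
From HB Require Import structures.
From mathcomp Require Import all_boot all_order all_algebra all_fingroup.
From mathcomp Require Import all_classical all_reals all_analysis.
From mathcomp Require Import ring.
Set Implicit Arguments.
Unset Strict Implicit.
Unset Printing Implicit Defensive.
Import Order.TTheory GRing.Theory Num.Theory numFieldNormedType.Exports.

Local Open Scope classical_set_scope.
Local Open Scope ring_scope.

(* Continuity of all partial derivatives of order at most k; the set U is
   meant to be open. *)
Fixpoint Ck_on (R : realType) n (U : set 'rV[R]_n) (k : nat)
    (f : 'rV[R]_n -> R) : Prop :=
  (forall x, U x -> {for x, continuous f}) /\
  if k is k'.+1 then
    forall i : 'I_n,
      (forall x, U x -> derivable f x 'e_i) /\
      Ck_on U k' (fun x => 'D_'e_i f x)
  else True.

Definition smooth_on (R : realType) n (U : set 'rV[R]_n) (f : 'rV[R]_n -> R) :=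
  forall k, Ck_on U k f.

(* A chart is a homeomorphism between the open sets [chart_dom] of M and
   [chart_img] of R^n; [chart_inv] is only meaningful on [chart_img]. *)
Record chart (R : realType) (n : nat) (M : topologicalType) := Chart {
  chart_dom : set M;
  chart_img : set 'rV[R]_n;
  chart_map : M -> 'rV[R]_n;
  chart_inv : 'rV[R]_n -> M;
  chart_dom_open : open chart_dom;
  chart_img_open : open chart_img;
  chart_mapP : forall x, chart_dom x -> chart_img (chart_map x);
  chart_invP : forall y, chart_img y -> chart_dom (chart_inv y);
  chart_mapK : forall x, chart_dom x -> chart_inv (chart_map x) = x;
  chart_invK : forall y, chart_img y -> chart_map (chart_inv y) = y;
  chart_map_cont : forall x, chart_dom x -> {for x, continuous chart_map};
  chart_inv_cont : forall y, chart_img y -> {for y, continuous chart_inv}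
}.

Record manifold (R : realType) (n : nat) := Manifold {
  mpoint :> topologicalType;
  mhausdorff : hausdorff_space mpoint;
  msecond_countable : @second_countable mpoint;
  atlas : set (chart R n mpoint);
  atlas_cover : forall x, exists2 c, atlas c & chart_dom c x;
  atlas_compat : forall c d, atlas c -> atlas d -> forall j : 'I_n,
    smooth_on [set y | chart_img c y /\ chart_dom d (chart_inv c y)]
      (fun y => chart_map d (chart_inv c y) 0 j)
}.

Definition smooth (R : realType) n (M : manifold R n) (f : M -> R) :=
  forall c, atlas c -> smooth_on (chart_img c) (f \o chart_inv c).

Section SmoothAlgebra.
Variables (R : realType) (n : nat).
Implicit Types (U : set 'rV[R]_n) (f g : 'rV[R]_n -> R).

Lemma Ck_on_ext U k f g : open U -> (forall x, U x -> f x = g x) ->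
  Ck_on U k f -> Ck_on U k g.
Proof.
move=> oU; have near_fg (u v : 'rV[R]_n -> R) x : (forall x, U x -> u x = v x) ->
    U x -> \forall y \near x, u y = v y.
  move=> uv Ux; apply: (@filterS _ (nbhs x) _ U) => [y /uv //|].
  exact: open_nbhs_nbhs.
have cont_ext (u v : 'rV[R]_n -> R) : (forall x, U x -> u x = v x) ->
    (forall x, U x -> {for x, continuous u}) ->
    forall x, U x -> {for x, continuous v}.
  move=> uv cu x Ux; rewrite /prop_for /continuous_at -(uv _ Ux).
  apply: cvg_trans (cu _ Ux).
  exact: (@near_eq_cvg _ _ (nbhs x) _ u v (near_fg u v x uv Ux)).
elim: k f g => [|k IH] f g fg /= [cf df]; first by split=> //; exact: cont_ext cf.
split; first exact: cont_ext cf.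
move=> i; have [dfi ckf] := df i; split.
  by move=> x Ux; apply: near_eq_derivable (dfi x Ux); exact: near_fg.
by apply: IH ckf => x Ux; apply: near_eq_derive; exact: near_fg.
Qed.

Lemma Ck_onW U k f : Ck_on U k.+1 f -> Ck_on U k f.
Proof.
elim: k f => [|k IH] f [cf df]; split=> // i; have [d1 d2] := df i.
by split=> //; exact: IH.
Qed.

Lemma Ck_on_cst U k (a : R) : open U -> Ck_on U k (fun=> a).
Proof.
move=> oU; elim: k a => [|k IH] a /=; split=> //; try by move=> x _; apply: cst_continuous.
move=> i; split; first by move=> x _; exact (@derivable_cst _ _ _ a x _).
by apply: Ck_on_ext (IH 0) => // x _; rewrite derive_cst.
Qed.

Lemma Ck_on_add U k f g : open U -> Ck_on U k f -> Ck_on U k g ->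
  Ck_on U k (fun x => f x + g x).
Proof.
move=> oU; elim: k f g => [|k IH] f g [cf df] [cg dg]; split=> //;
  try by move=> x Ux; exact (cvgD (cf x Ux) (cg x Ux)).
move=> i; have [df1 df2] := df i; have [dg1 dg2] := dg i; split.
  by move=> x Ux; exact (derivableD (df1 x Ux) (dg1 x Ux)).
apply: Ck_on_ext (IH _ _ df2 dg2) => // x Ux.
by rewrite -[RHS]/('D_'e_i (f + g) x) deriveD //; [exact: df1|exact: dg1].
Qed.

Lemma Ck_on_mul U k f g : open U -> Ck_on U k f -> Ck_on U k g ->
  Ck_on U k (fun x => f x * g x).
Proof.
move=> oU; elim: k f g => [|k IH] f g hf hg.
  by case: hf hg => cf _ [cg _]; split=> // x Ux; exact (cvgM (cf x Ux) (cg x Ux)).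
have [hf' hg'] := (Ck_onW hf, Ck_onW hg).
case: hf hg => cf df [cg dg]; split.
  by move=> x Ux; exact (cvgM (cf x Ux) (cg x Ux)).
move=> i; have [df1 df2] := df i; have [dg1 dg2] := dg i; split.
  by move=> x Ux; exact (derivableM (df1 x Ux) (dg1 x Ux)).
apply: Ck_on_ext (Ck_on_add oU (IH _ _ hf' dg2) (IH _ _ hg' df2)) => // x Ux.
by rewrite -[RHS]/('D_'e_i (f * g) x) deriveM //; [exact: df1|exact: dg1].
Qed.

Variable M : manifold R n.
Implicit Types u v : M -> R.

Lemma smooth_cst (a : R) : smooth (fun _ : M => a).
Proof. by move=> c _ k; apply: Ck_on_cst; exact: chart_img_open. Qed.

Lemma smooth_add u v : smooth u -> smooth v -> smooth (fun x => u x + v x).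
Proof.
by move=> su sv c ac k; apply: Ck_on_add; [exact: chart_img_open|exact: su|exact: sv].
Qed.

Lemma smooth_mul u v : smooth u -> smooth v -> smooth (fun x => u x * v x).
Proof.
by move=> su sv c ac k; apply: Ck_on_mul; [exact: chart_img_open|exact: su|exact: sv].
Qed.

Lemma smooth_lin (a : R) u v :
  smooth u -> smooth v -> smooth (fun x => a * u x + v x).
Proof. by move=> su sv; apply: smooth_add => //; apply: smooth_mul => //; exact: smooth_cst. Qed.

Lemma smooth_sub u v : smooth u -> smooth v -> smooth (fun x => u x - v x).
Proof.
move=> su sv; have -> : (fun x => u x - v x) = (fun x => -1 * v x + u x).
  by apply/funext => x; rewrite mulN1r addrC.
exact: smooth_lin.
Qed.

End SmoothAlgebra.

(* Derivations at x of the algebra of smooth functions.  They are extended by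
   0 to the non-smooth functions, so that two tangent vectors are equal as soon
   as they agree on the smooth functions. *)
Definition is_derivation (R : realType) n (M : manifold R n) (x : M)
    (v : (M -> R) -> R^o) : Prop :=
  [/\ forall (a : R) f g, smooth f -> smooth g ->
        v (fun y => a * f y + g y) = a * v f + v g,
      forall f g, smooth f -> smooth g ->
        v (fun y => f y * g y) = v f * g x + f x * v g
    & forall f, ~ smooth f -> v f = 0].

Definition derivation_pred (R : realType) n (M : manifold R n) (x : M) :
  {pred ((M -> R) -> R^o)} := fun v => `[< is_derivation x v >].

Lemma derivation_closed (R : realType) n (M : manifold R n) (x : M) :
  submod_closed (derivation_pred x).
Proof.
split.
  apply/asboolP; split=> //.
  - by move=> a f g _ _; rewrite -[LHS]/0 -[RHS]/(a * 0 + 0) mulr0 addr0.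
  - by move=> f g _ _; rewrite -[LHS]/0 -[RHS]/(0 * g x + f x * 0) mulr0 mul0r addr0.
move=> b u v /asboolP[u1 u2 u3] /asboolP[v1 v2 v3]; apply/asboolP.
pose w h : R := b * u h + v h.
suff : is_derivation x (w : _ -> R^o) by [].
rewrite /w; split.
- by move=> a f g sf sg; rewrite u1 // v1 // !mulrDr !mulrA (mulrC b a) addrACA.
- move=> f g sf sg; rewrite u2 // v2 //.
  by rewrite !mulrDr !mulrDl !mulrA (mulrC b (f x)) addrACA.
- by move=> f nf; rewrite u3 // v3 // mulr0 addr0.
Qed.

HB.instance Definition _ (R : realType) n (M : manifold R n) (x : M) :=
  GRing.isSubmodClosed.Build R ((M -> R) -> R^o) (derivation_pred x)
    (derivation_closed x).

Record tangent (R : realType) n (M : manifold R n) (x : M) := Tangent {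
  tangent_fun :> (M -> R) -> R^o;
  tangentP : tangent_fun \in derivation_pred x
}.

HB.instance Definition _ (R : realType) n (M : manifold R n) (x : M) :=
  [isSub for @tangent_fun R n M x].
HB.instance Definition _ (R : realType) n (M : manifold R n) (x : M) :=
  [Choice of tangent x by <:].
HB.instance Definition _ (R : realType) n (M : manifold R n) (x : M) :=
  [SubChoice_isSubLmodule of tangent x by <:].

Record vfield (R : realType) n (M : manifold R n) := VField {
  vfield_at :> forall x : M, tangent x;
  vfield_smooth : forall f, smooth f -> smooth (fun x => vfield_at x f : R)
}.

Section Bracket.
Variables (R : realType) (n : nat) (M : manifold R n) (X Y : vfield M).

Definition vbracket_fun (x : M) (f : M -> R) : R^o :=
  X x (fun y => Y y f) - Y x (fun y => X y f).

Lemma vbracket_derivation x : vbracket_fun x \in derivation_pred x.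
Proof.
have der (Z : vfield M) y := asboolW (tangentP (Z y)).
have der0 (Z : vfield M) y : Z y (fun=> 0) = 0.
  have [lin _ _] := der Z y; have s0 := @smooth_cst R n M 0.
  have E : (fun z : M => -1 * 0 + 0) = (fun=> 0 : R).
    by apply/funext => z; rewrite mulr0 addr0.
  by have := lin (-1) _ _ s0 s0; rewrite E => ->; ring.
apply/asboolP; rewrite /vbracket_fun; split.
- move=> a f g sf sg.
  have E (Z : vfield M) :
      (fun y => Z y (fun z => a * f z + g z)) = (fun y => a * Z y f + Z y g).
    by apply/funext => y; have [lin _ _] := der Z y; rewrite lin.
  rewrite !E; have [linX _ _] := der X x; have [linY _ _] := der Y x.
  rewrite linX ?linY; try exact: vfield_smooth.
  by rewrite mulrBr opprD addrACA.
- move=> f g sf sg.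
  have E (Z : vfield M) :
      (fun y => Z y (fun z => f z * g z)) = (fun y => 1 * (Z y f * g y) + f y * Z y g).
    by apply/funext => y; have [_ lei _] := der Z y; rewrite lei // mul1r.
  have S (Z : vfield M) h : smooth h -> smooth (fun y => Z y h : R).
    exact: vfield_smooth.
  rewrite !E; have [linX leiX _] := der X x; have [linY leiY _] := der Y x.
  rewrite linX ?linY; try by apply: smooth_mul => //; exact: S.
  rewrite !mul1r !leiX ?leiY //; try exact: S.
  ring.
- move=> f nf.
  have E (Z : vfield M) : (fun y => Z y f) = (fun=> 0).
    by apply/funext => y; have [_ _ ->] := der Z y.
  by rewrite !E !der0 subrr.
Qed.

Lemma vbracket_smooth f : smooth f ->
  smooth (fun x => Tangent (vbracket_derivation x) f : R).
Proof.
by move=> sf; apply: smooth_sub; apply: vfield_smooth; exact: vfield_smooth.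
Qed.

Definition vbracket : vfield M := VField vbracket_smooth.

End Bracket.

Record lieAlgebra (R : realType) := LieAlgebra {
  lie_space :> vectType R;
  lbr : lie_space -> lie_space -> lie_space;
  lbr_linear_l : forall z, linear (fun x => lbr x z);
  lbr_linear_r : forall x, linear (lbr x);
  lbr_alt : forall x, lbr x x = 0;
  lbr_jacobi : forall x y z,
    lbr x (lbr y z) + lbr y (lbr z x) + lbr z (lbr x y) = 0
}.

Definition g_manifold (R : realType) n (M : manifold R n) (g : lieAlgebra R)
    (zeta : g -> vfield M) : Prop :=
  (forall x, linear (fun X => zeta X x)) /\
  (forall X Y x, zeta (lbr X Y) x = vbracket (zeta X) (zeta Y) x).

Definition free_g_manifold (R : realType) n (M : manifold R n)
    (g : lieAlgebra R) (zeta : g -> vfield M) : Prop :=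
  forall x, injective (fun X => zeta X x).

Definition multilinear (R : realType) (V W : lmodType R) p
    (f : ('I_p -> V) -> W) : Prop :=
  forall (v : 'I_p -> V) (i : 'I_p) (a : R) (u w : V),
    f [eta v with i |-> a *: u + w] =
    a *: f [eta v with i |-> u] + f [eta v with i |-> w].

Definition vcoord (R : realType) (V : vectType R) (i : 'I_(\dim {:V})) (w : V) : R :=
  coord (vbasis {:V}) i w.

Definition pform (R : realType) n (M : manifold R n) (V : vectType R) (p : nat) :=
  forall x : M, ('I_p -> tangent x) -> V.

Section Forms.
Variables (R : realType) (n : nat) (M : manifold R n).

Definition is_form (V : vectType R) p (phi : pform M V p) : Prop :=
  [/\ forall x, multilinear (phi x),
      forall x (v : 'I_p -> tangent x) i j, i != j -> v i = v j -> phi x v = 0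
    & forall (X : 'I_p -> vfield M) i,
        smooth (fun x => vcoord i (phi x (fun j => X j x)))].

(* The derivative along v of a V-valued function, coordinate by coordinate. *)
Definition vderiv (V : vectType R) (x : M) (v : tangent x) (F : M -> V) : V :=
  \sum_(i < \dim {:V}) v (fun y => vcoord i (F y)) *: (vbasis {:V})`_i.

Definition lie_deriv (V : vectType R) p (X : vfield M) (phi : pform M V p)
    (Y : 'I_p -> vfield M) (x : M) : V :=
  vderiv (X x) (fun y => phi y (fun j => Y j y))
  - \sum_(i < p) phi x (fun j => [eta Y with i |-> vbracket X (Y i)] j x).

(* The invariant formula for the exterior derivative at X_0, ..., X_p.
   The term in [X_i, X_j], i < j, is usually written
     (-1)^(i+j) phi([X_i, X_j], X_0, .., ^i, .., ^j, .., X_p);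
   here the bracket is moved to the slot of X_j (which is slot j-1 of the
   family without X_i), at the cost of the sign (-1)^(j-1).  The index l below
   is that slot: j = lift i l, and i < j amounts to i <= l. *)
Definition koszul (V : vectType R) p (phi : pform M V p)
    (X : 'I_p.+1 -> vfield M) (x : M) : V :=
  \sum_(i < p.+1) (-1) ^+ i *:
    (vderiv (X i x) (fun y => phi y (fun j => X (lift i j) y))
     - \sum_(l < p | (i <= l)%N)
         phi x (fun j =>
           [eta (fun j => X (lift i j)) with l |-> vbracket (X i) (X (lift i l))] j x)).

(* eta = d phi, where phi is a form.  Every tangent vector is the value of a
   global vector field, so that forms are determined by their values on vector
   fields: eta is unique, and identities between forms, as in the definitions
   of equivariant and horizontal forms below, are tested on vector fields. *)
Definition is_ext_deriv (V : vectType R) p (phi : pform M V p)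
    (eta : pform M V p.+1) : Prop :=
  is_form eta /\
  forall (X : 'I_p.+1 -> vfield M) x, eta x (fun i => X i x) = koszul phi X x.

Definition pform0 (V : vectType R) p : pform M V p := fun _ _ => 0.

Definition pform_sub (V : vectType R) p (phi psi : pform M V p) : pform M V p :=
  fun x v => phi x v - psi x v.

Definition wedge (V W U : vectType R) (m : V -> W -> U) p q
    (phi : pform M V p) (psi : pform M W q) : pform M U (p + q) :=
  fun x v => ((p`! * q`!)%:R)^-1 *:
    \sum_(s : 'S_(p + q)) (-1) ^+ s *:
      m (phi x (fun i => v (s (lshift q i)))) (psi x (fun j => v (s (rshift p j)))).

(* Cohomology of a complex [C] of real-valued forms: the classes of phi and psi
   coincide.  There are no forms of degree -1. *)
Definition closed_in (C : forall p, pform M R^o p -> Prop) p (phi : pform M R^o p) :=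
  C p phi /\ is_ext_deriv phi (@pform0 R^o p.+1).

Definition exact_in (C : forall p, pform M R^o p -> Prop) p :
    pform M R^o p -> Prop :=
  match p return pform M R^o p -> Prop with
  | 0 => fun phi => phi = @pform0 R^o 0
  | q.+1 => fun phi => exists psi : pform M R^o q, C q psi /\ is_ext_deriv psi phi
  end.

Definition same_class (C : forall p, pform M R^o p -> Prop) p
    (phi psi : pform M R^o p) : Prop :=
  [/\ closed_in C phi, closed_in C psi & exact_in C (pform_sub phi psi)].

End Forms.

Section GForms.
Variables (R : realType) (n : nat) (M : manifold R n) (g : lieAlgebra R).
Variable zeta : g -> vfield M.

Definition equivariant_form p (psi : pform M g p) : Prop :=
  is_form psi /\
  forall X (Y : 'I_p -> vfield M) x,
    lie_deriv (zeta X) psi Y x = - lbr X (psi x (fun j => Y j x)).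

Definition principal_connection (omega : pform M g 1) : Prop :=
  equivariant_form omega /\
  forall x X, zeta (omega x (fun=> zeta X x)) x = zeta X x.

Definition is_curvature (omega : pform M g 1) (Omega : pform M g 2) : Prop :=
  exists2 domega : pform M g 2, is_ext_deriv omega domega &
    Omega = fun x v =>
      domega x v + lbr (omega x (fun=> v ord0)) (omega x (fun=> v ord_max)).

(* i_(zeta X) phi = 0; vacuous in degree 0. *)
Definition horizontal (V : vectType R) p (phi : pform M V p) : Prop :=
  forall X (Y : 'I_p -> vfield M) (i : 'I_p), i = 0%N :> nat -> Y i = zeta X ->
    forall x, phi x (fun j => Y j x) = 0.

Definition basic p (phi : pform M R^o p) : Prop :=
  [/\ is_form phi, horizontal phi
    & forall X (Y : 'I_p -> vfield M) x, lie_deriv (zeta X) phi Y x = 0].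

Definition invariant_multilinear k (f : ('I_k -> g) -> R^o) : Prop :=
  multilinear f /\
  forall X (Y : 'I_k -> g), \sum_(i < k) f [eta Y with i |-> lbr X (Y i)] = 0.

(* The elements of the k-th tensor power of g, in coordinates with respect to
   [vbasis {:g}]. *)
Definition tensor_space k : vectType R :=
  {ffun {ffun 'I_k -> 'I_(\dim {:g})} -> R^o}.

Definition tensor k (a : g) (t : tensor_space k) : tensor_space k.+1 :=
  [ffun I : {ffun 'I_k.+1 -> 'I_(\dim {:g})} =>
     vcoord (I ord0) a * t [ffun j => I (lift ord0 j)]].

Definition tensor_apply k (f : ('I_k -> g) -> R^o) (t : tensor_space k) : R^o :=
  \sum_(I : {ffun 'I_k -> 'I_(\dim {:g})}) t I *: f (fun j => (vbasis {:g})`_(I j)).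

(* The iterated product of k factors Omega, starting from the constant 1 in
   the 0-th tensor power. *)
Fixpoint wedge_power (Omega : pform M g 2) k : pform M (tensor_space k) k.*2 :=
  match k return pform M (tensor_space k) k.*2 with
  | 0 => fun _ _ => [ffun=> 1]
  | j.+1 => wedge (@tensor j) Omega (@wedge_power Omega j)
  end.

Definition chern_weil k (f : ('I_k -> g) -> R^o) (Omega : pform M g 2) :
    pform M R^o k.*2 :=
  fun x v => tensor_apply f (@wedge_power Omega k x v).

End GForms.

(* Main.v *)
Require Import Defs.
From HB Require Import structures.
From mathcomp Require Import all_boot all_order all_algebra all_fingroup.
From mathcomp Require Import all_classical all_reals all_analysis.
From mathcomp Require Import zify ring lra.
Set Implicit Arguments.
Unset Strict Implicit.
Unset Printing Implicit Defensive.
Import Order.TTheory GRing.Theory Num.Theory numFieldNormedType.Exports.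
Local Open Scope ring_scope.

(** Write [alt F] for the signed sum of F over all permutations of its
arguments.  Up to the factor 2^-k, the Chern-Weil form of f and Omega is
[alt F] with F(v) = f(Omega(v_0, v_1), Omega(v_2, v_3), ...)
([chern_weilE]), so every identity about it can be checked under [alt], where
arguments may be permuted at the cost of a sign.

The exterior derivative is compatible with this.  Let D F be the operation
  D F(X, Y) = X.F(Y) - 1/2 sum_l F(Y with [X, Y_l] in place of Y_l),
that is, the Lie derivative with its second half halved.  Then
d(alt F) = alt(D F), up to the sign of the argument in which X is placed
([koszul_altf]): antisymmetrizing counts each pair of arguments of the Koszul
formula twice.  On a product of forms over disjoint blocks of arguments, D
satisfies the Leibniz rule ([lie_part_block_product]), so that d(alt F) is a
sum of terms in which a single factor Omega is replaced by D Omega.  Under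
[alt] only the cyclic sum of D Omega matters, and by the Bianchi identity it
is the one of -[omega(X), Omega(Y, Z)] ([bianchi], [alt_bianchi]).  The
invariance of f makes the sum of all these terms vanish, before any
antisymmetrization: the form is closed ([koszul_curvature_power]).

For the comparison, put theta = omega_b - omega_a and
omega_t = omega_a + t theta, with curvature Omega_t.  Replacing the m-th
factor Omega_t of F by theta gives the form Q_(m,t) of degree 2k - 1; the same
computation shows that 2 d(alt Q_(m,t)) is alt of F with the m-th factor
Omega_t replaced by its derivative in t, since invariance of f turns the terms
in [omega_t, Omega_t] into the missing term [omega_t, theta] of that
derivative ([koszul_transgression]).  Summing over m gives d/dt of f^Omega_t.
As this is polynomial in t, its integral over the unit interval is a finite
linear combination of its values, with coefficients that do not depend on the
point or on the arguments ([exact_quadrature]); hence the difference of the two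
forms is d of the same linear combination of the forms alt Q_(m,t)
([transgression]).

On a free manifold, omega(zeta_X) = X, so theta kills the vertical vectors, and
equivariance of omega_t makes Omega_t horizontal ([curvature_vertical]).  All
factors of F and Q_(m,t) are then horizontal and equivariant, and therefore the
forms alt F and alt Q_(m,t) are basic ([basic_alt_block_product]). *)

(** * Alternation *)

Section Alternation.
Variables (R : realType) (W : lmodType R).

Definition alt (T : Type) p (F : ('I_p -> T) -> W) (v : 'I_p -> T) : W :=
  \sum_(s : 'S_p) (-1) ^+ s *: F (fun i => v (s i)).

Variables (T : Type).
Implicit Types (p : nat).

Lemma eq_alt p (F G : ('I_p -> T) -> W) v :
  (forall w, F w = G w) -> alt F v = alt G v.
Proof. by move=> FG; apply: eq_bigr => s _; rewrite FG. Qed.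

Lemma alt_perm p (F : ('I_p -> T) -> W) v (u : 'S_p) :
  alt F (fun i => v (u i)) = (-1) ^+ u *: alt F v.
Proof.
rewrite /alt (reindex_inj (mulIg u^-1)%g) scaler_sumr; apply: eq_bigr => s _ /=.
rewrite scalerA odd_permM odd_permV addbC signr_addb; congr (_ *: F _).
by apply/funext => i; rewrite permM permKV.
Qed.

Lemma alt_reindex p (F : ('I_p -> T) -> W) v (u : 'S_p) :
  alt (fun w => F (fun i => w (u i))) v = (-1) ^+ u *: alt F v.
Proof.
rewrite /alt (reindex_inj (mulgI u^-1)%g) scaler_sumr; apply: eq_bigr => s _ /=.
rewrite scalerA odd_permM odd_permV signr_addb; congr (_ *: F _).
by apply/funext => i; rewrite permM permK.
Qed.

Lemma alt_lin p (F G : ('I_p -> T) -> W) a v :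
  alt (fun w => a *: F w + G w) v = a *: alt F v + alt G v.
Proof.
rewrite /alt scaler_sumr -big_split; apply: eq_bigr => s _ /=.
by rewrite scalerDr !scalerA mulrC.
Qed.

Lemma alt0 p v : alt (fun _ : 'I_p -> T => 0) v = 0.
Proof. by rewrite /alt big1 // => s _; rewrite scaler0. Qed.

Lemma alt_sum p I (r : seq I) (P : pred I) (F : I -> ('I_p -> T) -> W) v :
  alt (fun w => \sum_(i <- r | P i) F i w) v = \sum_(i <- r | P i) alt (F i) v.
Proof.
rewrite /alt exchange_big; apply: eq_bigr => s _ /=; by rewrite scaler_sumr.
Qed.

Lemma altD p (F G : ('I_p -> T) -> W) v :
  alt (fun w => F w + G w) v = alt F v + alt G v.
Proof. by rewrite -[X in X + _]scale1r -alt_lin; apply: eq_alt => w; rewrite scale1r. Qed.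

Definition rot3 p (a b c : 'I_p) : 'S_p := (tperm a b * tperm a c)%g.

Lemma rot3E p (a b c : 'I_p) : a != b -> a != c -> b != c ->
  [/\ rot3 a b c a = b, rot3 a b c b = c, rot3 a b c c = a &
   forall i, i != a -> i != b -> i != c -> rot3 a b c i = i].
Proof.
move=> ab ac bc; rewrite /rot3; split=> [||| i ia ib ic].
- by rewrite permM tpermL tpermD // eq_sym.
- by rewrite permM tpermR tpermL.
- by rewrite permM (tpermD ac bc) tpermR.
- by rewrite permM !tpermD // eq_sym.
Qed.

Lemma odd_rot3 p (a b c : 'I_p) : a != b -> a != c -> rot3 a b c = false :> bool.
Proof. by move=> ab ac; rewrite /rot3 odd_permM !odd_tperm ab ac. Qed.

(** A cyclic permutation of three arguments is even, so [alt] does not see it: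
if an entry e of H depends only on three arguments on which the rest of H does
not depend, only the cyclic sum of e matters. *)
Lemma alt_cyclic p (V : zmodType) (H : ('I_p -> T) -> V -> W) (E : T -> T -> T -> V)
    (E' : T -> T -> T -> V) (a b c : 'I_p) v :
  a != b -> a != c -> b != c ->
  (forall w, {morph H w : e e' / e + e'}) ->
  (forall w w', (forall i, i != a -> i != b -> i != c -> w i = w' i) -> H w = H w') ->
  (forall x y z, E x y z + E y z x + E z x y = E' x y z + E' y z x + E' z x y) ->
  alt (fun w => H w (E (w a) (w b) (w c))) v =
  alt (fun w => H w (E' (w a) (w b) (w c))) v.
Proof.
move=> ab ac bc HD Hloc EE'.
have rot (D : T -> T -> T -> V) :
    alt (fun w => H w (D (w a) (w b) (w c))) v =
    alt (fun w => H w (D (w b) (w c) (w a))) v.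
  have [ra rb rc ri] := rot3E ab ac bc.
  have := alt_reindex (fun w => H w (D (w a) (w b) (w c))) v (rot3 a b c).
  rewrite (odd_rot3 ab ac) expr0 scale1r => <-.
  apply: eq_alt => w; rewrite ra rb rc.
  by rewrite (Hloc _ w) // => i ia ib ic; rewrite ri.
have rot' D := rot (fun x y z => D y z x).
have cyc D : 3%:R *: alt (fun w => H w (D (w a) (w b) (w c))) v =
    alt (fun w => H w (D (w a) (w b) (w c) + D (w b) (w c) (w a) + D (w c) (w a) (w b))) v.
  transitivity (alt (fun w => H w (D (w a) (w b) (w c))) v +
      alt (fun w => H w (D (w b) (w c) (w a))) v +
      alt (fun w => H w (D (w c) (w a) (w b))) v).
    by rewrite -rot' -rot scaler_nat !mulrS mulr0n addr0 addrA.
  by rewrite -!altD; apply: eq_alt => w; rewrite !HD.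
apply: (scalerI (_ : 3%:R != 0 :> R)); first by rewrite pnatr_eq0.
by rewrite !cyc; apply: eq_alt => w; rewrite EE'.
Qed.

(** The transposition of a and b is odd, so both halves of an antisymmetric
entry contribute the same. *)
Lemma alt_swap p (V : zmodType) (H : ('I_p -> T) -> V -> W) (E : T -> T -> V)
    (a b : 'I_p) v :
  a != b -> (forall w, {morph H w : e e' / e - e'}) ->
  (forall w w', (forall i, i != a -> i != b -> w i = w' i) -> H w = H w') ->
  alt (fun w => H w (E (w a) (w b) - E (w b) (w a))) v =
  2%:R *: alt (fun w => H w (E (w a) (w b))) v.
Proof.
move=> ab HB Hloc.
have -> : alt (fun w => H w (E (w a) (w b) - E (w b) (w a))) v =
    alt (fun w => H w (E (w a) (w b))) v - alt (fun w => H w (E (w b) (w a))) v.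
  by rewrite addrC -scaleN1r -alt_lin; apply: eq_alt => w; rewrite HB scaleN1r addrC.
have -> : alt (fun w => H w (E (w b) (w a))) v =
    alt (fun w => (fun w => H w (E (w a) (w b))) (fun i => w (tperm a b i))) v.
  apply: eq_alt => w; rewrite tpermL tpermR.
  by rewrite (Hloc _ w) // => i ia ib; rewrite tpermD // eq_sym.
by rewrite (alt_reindex (fun w => H w (E (w a) (w b)))) odd_tperm ab expr1 scaleN1r opprK scaler_nat mulr2n.
Qed.

Lemma alt_repeat p (F : ('I_p -> T) -> W) v i j : i != j -> v i = v j -> alt F v = 0.
Proof.
move=> ij vij; have := alt_perm F v (tperm i j).
have -> : (fun l => v (tperm i j l)) = v.
  by apply/funext => l; case: tpermP => [->|->|].
rewrite odd_tperm ij expr1 scaleN1r => /eqP.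
rewrite -subr_eq0 opprK -mulr2n -scaler_nat scaler_eq0 pnatr_eq0 /=.
by move/eqP.
Qed.

End Alternation.

Section PairSums.
Variables (W : zmodType).

Lemma big_lift n (i : 'I_n.+1) (P : pred 'I_n.+1) (h : 'I_n.+1 -> W) :
  \sum_(l < n | P (lift i l)) h (lift i l) = \sum_(j | (j != i) && P j) h j.
Proof.
pose Q j := (j == i) || P j.
have Qi : Q i by rewrite /Q eqxx.
apply: (@addrI _ (h i)); rewrite (eq_bigl (fun l => Q (lift i l))); last first.
  by move=> l; rewrite /Q eq_sym (negPf (neq_lift i l)).
rewrite -(@bigD1_ord _ _ _ n.+1 i Q h Qi) (bigD1 i) //=; congr (_ + _); apply: eq_bigl => j.
by rewrite /Q; case: (j == i); rewrite ?andbT.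
Qed.

Lemma sum_sym_pairs n (h : 'I_n -> 'I_n -> W) : (forall i j, i != j -> h i j = h j i) ->
  (\sum_(i < n) \sum_(j < n | (i < j)%N) h i j) *+ 2 = \sum_i \sum_(j | j != i) h i j.
Proof.
move=> hs.
have -> : \sum_i \sum_(j | j != i) h i j =
    \sum_(i < n) \sum_(j < n | (i < j)%N) h i j +
    \sum_(i < n) \sum_(j < n | (j < i)%N) h i j.
  rewrite -big_split /=; apply: eq_bigr => i _.
  rewrite (bigID (fun j : 'I_n => (i < j)%N)) /=; congr (_ + _); apply: eq_bigl => j.
    by rewrite andb_idl // => ij; rewrite -val_eqE /= gtn_eqF.
  by rewrite -leqNgt ltn_neqAle -val_eqE.
rewrite mulr2n; congr (_ + _).
rewrite (exchange_big_dep predT) //=; apply: eq_bigr => j _; apply: eq_bigr => i ij.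
by apply: hs; rewrite -val_eqE /= ltn_eqF.
Qed.

End PairSums.

(** * Vector-valued smooth functions and their derivatives *)

Section SmoothVectorFunctions.
Variables (R : realType) (n : nat) (M : manifold R n).

Definition smoothv (V : vectType R) (F : M -> V) : Prop :=
  forall i, smooth (fun y => vcoord i (F y)).

Lemma vcoordD (V : vectType R) i (u w : V) : vcoord i (u + w) = vcoord i u + vcoord i w.
Proof. by rewrite /vcoord linearD. Qed.
Lemma vcoordZ (V : vectType R) i a (u : V) : vcoord i (a *: u) = a * vcoord i u.
Proof. by rewrite /vcoord linearZ. Qed.
Lemma vcoord0 (V : vectType R) i : vcoord i (0 : V) = 0.
Proof. by rewrite /vcoord linear0. Qed.
Lemma vcoordN (V : vectType R) i (u : V) : vcoord i (- u) = - vcoord i u.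
Proof. by rewrite /vcoord linearN. Qed.
Lemma vcoordB (V : vectType R) i (u w : V) : vcoord i (u - w) = vcoord i u - vcoord i w.
Proof. by rewrite vcoordD vcoordN. Qed.
Lemma vcoord_sum (V : vectType R) i I (r : seq I) (P : pred I) (F : I -> V) :
  vcoord i (\sum_(j <- r | P j) F j) = \sum_(j <- r | P j) vcoord i (F j).
Proof. by rewrite /vcoord linear_sum. Qed.

Lemma vcoordK (V : vectType R) (u : V) :
  u = \sum_(i < \dim {:V}) vcoord i u *: (vbasis {:V})`_i.
Proof. exact: coord_vbasis (memvf u). Qed.

Lemma vcoord_basis (V : vectType R) (i j : 'I_(\dim {:V})) :
  vcoord i (vbasis {:V})`_j = (i == j)%:R.
Proof. by rewrite /vcoord coord_free ?(basis_free (vbasisP _)) // eq_sym. Qed.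

Lemma vcoord_inj (V : vectType R) (u w : V) :
  (forall i, vcoord i u = vcoord i w) -> u = w.
Proof.
by move=> uw; rewrite [u]vcoordK [w]vcoordK; apply: eq_bigr => i _; rewrite uw.
Qed.

Lemma smooth_sum I (r : seq I) (P : pred I) (u : I -> M -> R) :
  (forall i, P i -> smooth (u i)) -> smooth (fun y => \sum_(i <- r | P i) u i y).
Proof.
move=> su; elim: r => [|i r IH].
  by rewrite (_ : (fun y => _) = fun=> 0); [exact: smooth_cst | apply/funext => y; rewrite big_nil].
have [Pi|nPi] := boolP (P i).
  rewrite (_ : (fun y => _) = fun y => u i y + \sum_(i <- r | P i) u i y).
    by apply: smooth_add => //; exact: su.
  by apply/funext => y; rewrite big_cons Pi.
rewrite (_ : (fun y => _) = fun y => \sum_(i <- r | P i) u i y) //.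
by apply/funext => y; rewrite big_cons (negPf nPi).
Qed.

Lemma smooth_prod I (r : seq I) (P : pred I) (u : I -> M -> R) :
  (forall i, P i -> smooth (u i)) -> smooth (fun y => \prod_(i <- r | P i) u i y).
Proof.
move=> su; elim: r => [|i r IH].
  by rewrite (_ : (fun y => _) = fun=> 1); [exact: smooth_cst | apply/funext => y; rewrite big_nil].
have [Pi|nPi] := boolP (P i).
  rewrite (_ : (fun y => _) = fun y => u i y * \prod_(i <- r | P i) u i y).
    by apply: smooth_mul => //; exact: su.
  by apply/funext => y; rewrite big_cons Pi.
rewrite (_ : (fun y => _) = fun y => \prod_(i <- r | P i) u i y) //.
by apply/funext => y; rewrite big_cons (negPf nPi).
Qed.

Lemma smoothv_lin (V : vectType R) a (F G : M -> V) :
  smoothv F -> smoothv G -> smoothv (fun y => a *: F y + G y).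
Proof.
move=> sF sG i; rewrite (_ : (fun y => _) = fun y => a * vcoord i (F y) + vcoord i (G y)).
  exact: smooth_lin.
by apply/funext => y; rewrite vcoordD vcoordZ.
Qed.

Lemma smoothv_cst (V : vectType R) (u : V) : smoothv (fun=> u).
Proof. by move=> i; exact: smooth_cst. Qed.

Lemma smoothvZ (V : vectType R) a (F : M -> V) : smoothv F -> smoothv (fun y => a *: F y).
Proof.
move=> sF; rewrite (_ : (fun y => _) = fun y => a *: F y + 0).
  exact: smoothv_lin (smoothv_cst 0).
by apply/funext => y; rewrite addr0.
Qed.

Lemma smoothvD (V : vectType R) (F G : M -> V) :
  smoothv F -> smoothv G -> smoothv (fun y => F y + G y).
Proof.
move=> sF sG; rewrite (_ : (fun y => _) = fun y => 1 *: F y + G y); first exact: smoothv_lin.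
by apply/funext => y; rewrite scale1r.
Qed.

Lemma smoothvN (V : vectType R) (F : M -> V) : smoothv F -> smoothv (fun y => - F y).
Proof.
move=> sF; rewrite (_ : (fun y => _) = fun y => -1 *: F y); first exact: smoothvZ.
by apply/funext => y; rewrite scaleN1r.
Qed.

Lemma smoothvB (V : vectType R) (F G : M -> V) :
  smoothv F -> smoothv G -> smoothv (fun y => F y - G y).
Proof. by move=> sF sG; apply: smoothvD => //; exact: smoothvN. Qed.

Lemma smoothv_sum (V : vectType R) I (r : seq I) (P : pred I) (u : I -> M -> V) :
  (forall i, P i -> smoothv (u i)) -> smoothv (fun y => \sum_(i <- r | P i) u i y).
Proof.
move=> su i; rewrite (_ : (fun y => _) = fun y => \sum_(j <- r | P j) vcoord i (u j y)).
  by apply: smooth_sum => j Pj; exact: su.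
by apply/funext => y; rewrite vcoord_sum.
Qed.

Lemma smoothv_scale (V : vectType R) (h : M -> R) (u : V) :
  smooth h -> smoothv (fun y => h y *: u).
Proof.
move=> sh i; rewrite (_ : (fun y => _) = fun y => h y * vcoord i u).
  by apply: smooth_mul => //; exact: smooth_cst.
by apply/funext => y; rewrite vcoordZ.
Qed.

Section Derivation.
Variables (x : M) (v : tangent x).

Let dv := asboolW (tangentP v).

Lemma der_lin a (f h : M -> R) : smooth f -> smooth h ->
  v (fun y => a * f y + h y) = a * v f + v h.
Proof. by have [lin _ _] := dv; exact: lin. Qed.

Lemma der_mul (f h : M -> R) : smooth f -> smooth h ->
  v (fun y => f y * h y) = v f * h x + f x * v h.
Proof. by have [_ lei _] := dv; exact: lei. Qed.

Lemma der_cst a : v (fun=> a) = 0.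
Proof.
have v1 : v (fun=> 1) = 0.
  have := der_mul (smooth_cst 1) (smooth_cst 1).
  rewrite (_ : (fun=> 1 * 1) = fun=> 1 :> R); last by rewrite mulr1.
  by rewrite mulr1 mul1r => /eqP; rewrite -{1}[v _]addr0 (inj_eq (addrI _)) eq_sym => /eqP.
have := der_lin a (smooth_cst 1) (smooth_cst 1).
have := der_lin (a + 1) (smooth_cst 1) (smooth_cst 1).
have := der_lin (a - 1) (smooth_cst 1) (smooth_cst 1).
rewrite v1 !mulr0 !addr0 => + _ _; rewrite mulr1 (_ : (fun=> a - 1 + 1) = fun=> a) //.
by apply/funext => y; rewrite subrK.
Qed.

Lemma derZ a (f : M -> R) : smooth f -> v (fun y => a * f y) = a * v f.
Proof.
move=> sf; rewrite -[RHS]addr0 -(der_cst 0) -der_lin //; last exact: smooth_cst.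
by congr (v _); apply/funext => y; rewrite addr0.
Qed.

Lemma derD (f h : M -> R) : smooth f -> smooth h -> v (fun y => f y + h y) = v f + v h.
Proof.
move=> sf sh; rewrite -[v f]mul1r -der_lin //.
by congr (v _); apply/funext => y; rewrite mul1r.
Qed.

Lemma der_sum I (r : seq I) (P : pred I) (u : I -> M -> R) :
  (forall i, P i -> smooth (u i)) ->
  v (fun y => \sum_(i <- r | P i) u i y) = \sum_(i <- r | P i) v (u i).
Proof.
move=> su; elim: r => [|i r IH].
  rewrite big_nil -[RHS](der_cst 0); congr (v _); apply/funext => y; exact: big_nil.
rewrite big_cons -IH; case: (boolP (P i)) => [Pi|nPi].
  rewrite -derD; [|exact: su|exact: smooth_sum].
  by congr (v _); apply/funext => y; rewrite big_cons Pi.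
by congr (v _); apply/funext => y; rewrite big_cons (negPf nPi).
Qed.

(** Leibniz rule for an iterated product; the sequence has to be
duplicate-free because the factor to be differentiated is found by its index. *)
Lemma der_prod (I : eqType) (r : seq I) (u : I -> M -> R) : uniq r ->
  (forall i, smooth (u i)) ->
  v (fun y => \prod_(i <- r) u i y) =
  \sum_(i <- r) v (u i) * \prod_(j <- r | j != i) u j x.
Proof.
move=> + su; elim: r => [_|i r IH /= /andP[ir ur]].
  rewrite big_nil -[RHS](der_cst 1); congr (v _); apply/funext => y; exact: big_nil.
rewrite (_ : (fun y => _) = fun y => u i y * \prod_(j <- r) u j y); last first.
  by apply/funext => y; rewrite big_cons.
rewrite der_mul //; last exact: smooth_prod.
rewrite IH // big_cons big_cons eqxx /=; congr (_ + _).
  congr (_ * _); rewrite [RHS]big_seq_cond [LHS]big_seq; apply: eq_bigl => j.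
  by case: (boolP (j \in r)) => // jr; case: eqVneq jr ir => // -> ->.
rewrite mulr_sumr [LHS]big_seq [RHS]big_seq; apply: eq_bigr => j jr.
rewrite big_cons; case: eqVneq jr ir => [-> -> //|_ _ _]; last by rewrite mulrCA.
Qed.

Lemma vcoord_vderiv (V : vectType R) (F : M -> V) i :
  vcoord i (vderiv v F) = v (fun y => vcoord i (F y)).
Proof.
rewrite /vderiv vcoord_sum (bigD1 i) //= vcoordZ vcoord_basis eqxx mulr1 big1 ?addr0 //.
by move=> j ji; rewrite vcoordZ vcoord_basis eq_sym (negPf ji) mulr0.
Qed.

Lemma vderiv_lin (V : vectType R) a (F G : M -> V) : smoothv F -> smoothv G ->
  vderiv v (fun y => a *: F y + G y) = a *: vderiv v F + vderiv v G.
Proof.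
move=> sF sG; apply: vcoord_inj => i; rewrite vcoordD vcoordZ !vcoord_vderiv -der_lin //.
by congr (v _); apply/funext => y; rewrite vcoordD vcoordZ.
Qed.

Lemma vderiv_cst (V : vectType R) (u : V) : vderiv v (fun=> u) = 0.
Proof. by apply: vcoord_inj => i; rewrite vcoord_vderiv der_cst vcoord0. Qed.

Lemma vderivZ (V : vectType R) a (F : M -> V) : smoothv F ->
  vderiv v (fun y => a *: F y) = a *: vderiv v F.
Proof.
move=> sF; rewrite -[RHS]addr0 -(vderiv_cst 0) -vderiv_lin //; last exact: smoothv_cst.
by congr (vderiv _ _); apply/funext => y; rewrite addr0.
Qed.

Lemma vderivD (V : vectType R) (F G : M -> V) : smoothv F -> smoothv G ->
  vderiv v (fun y => F y + G y) = vderiv v F + vderiv v G.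
Proof.
move=> sF sG; rewrite -[X in X + _]scale1r -vderiv_lin //.
by congr (vderiv _ _); apply/funext => y; rewrite scale1r.
Qed.

Lemma vderivN (V : vectType R) (F : M -> V) : smoothv F ->
  vderiv v (fun y => - F y) = - vderiv v F.
Proof.
move=> sF; rewrite -scaleN1r -vderivZ //.
by congr (vderiv _ _); apply/funext => y; rewrite scaleN1r.
Qed.

Lemma vderivB (V : vectType R) (F G : M -> V) : smoothv F -> smoothv G ->
  vderiv v (fun y => F y - G y) = vderiv v F - vderiv v G.
Proof. by move=> sF sG; rewrite vderivD ?vderivN //; exact: smoothvN. Qed.

Lemma vderiv_sum (V : vectType R) I (r : seq I) (P : pred I) (u : I -> M -> V) :
  (forall i, P i -> smoothv (u i)) ->
  vderiv v (fun y => \sum_(i <- r | P i) u i y) = \sum_(i <- r | P i) vderiv v (u i).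
Proof.
move=> su; apply: vcoord_inj => i; rewrite vcoord_sum vcoord_vderiv.
rewrite (_ : (fun y => _) = fun y => \sum_(j <- r | P j) vcoord i (u j y)); last first.
  by apply/funext => y; rewrite vcoord_sum.
rewrite der_sum; first by apply: eq_bigr => j _; rewrite vcoord_vderiv.
by move=> j Pj; exact: su.
Qed.

Lemma vderiv_scale (V : vectType R) (h : M -> R) (u : V) : smooth h ->
  vderiv v (fun y => h y *: u) = v h *: u.
Proof.
move=> sh; apply: vcoord_inj => i; rewrite vcoordZ vcoord_vderiv mulrC -derZ //.
by congr (v _); apply/funext => y; rewrite vcoordZ mulrC.
Qed.

End Derivation.

Lemma smoothv_vderiv (V : vectType R) (X : vfield M) (F : M -> V) :
  smoothv F -> smoothv (fun y => vderiv (X y) F).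
Proof.
move=> sF i; rewrite (_ : (fun y => _) = fun y => X y (fun z => vcoord i (F z))).
  by apply: vfield_smooth; exact: sF.
by apply/funext => y; rewrite vcoord_vderiv.
Qed.

Lemma vderiv_bracket (V : vectType R) (X Y : vfield M) (F : M -> V) x :
  vderiv (vbracket X Y x) F =
  vderiv (X x) (fun y => vderiv (Y y) F) - vderiv (Y x) (fun y => vderiv (X y) F).
Proof.
apply: vcoord_inj => i; rewrite vcoordB !vcoord_vderiv /= /vbracket_fun.
by congr (X x _ - Y x _); apply/funext => y; rewrite vcoord_vderiv.
Qed.

End SmoothVectorFunctions.

(** * Multilinear maps *)

Section Multilinear.
Variable R : realType.

Lemma multilinearD (V W : lmodType R) k (f : ('I_k -> V) -> W) v i u w :
  multilinear f -> f [eta v with i |-> u + w] = f [eta v with i |-> u] + f [eta v with i |-> w].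
Proof. by move=> mf; have := mf v i 1 u w; rewrite !scale1r. Qed.

Lemma multilinear0 (V W : lmodType R) k (f : ('I_k -> V) -> W) v i :
  multilinear f -> f [eta v with i |-> 0] = 0.
Proof.
move=> mf; have := multilinearD v i 0 0 mf; rewrite addr0 => /eqP.
by rewrite -{1}[f _]addr0 (inj_eq (addrI _)) eq_sym => /eqP.
Qed.

Lemma multilinearZ (V W : lmodType R) k (f : ('I_k -> V) -> W) v i a u :
  multilinear f -> f [eta v with i |-> a *: u] = a *: f [eta v with i |-> u].
Proof. by move=> mf; rewrite -[a *: u]addr0 mf multilinear0 // addr0. Qed.

Lemma multilinearN (V W : lmodType R) k (f : ('I_k -> V) -> W) v i u :
  multilinear f -> f [eta v with i |-> - u] = - f [eta v with i |-> u].
Proof. by move=> mf; rewrite -(scaleN1r u) multilinearZ // scaleN1r. Qed.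

Lemma multilinearB (V W : lmodType R) k (f : ('I_k -> V) -> W) v i u w :
  multilinear f -> f [eta v with i |-> u - w] = f [eta v with i |-> u] - f [eta v with i |-> w].
Proof. by move=> mf; rewrite multilinearD // multilinearN. Qed.

Lemma multilinear_sum (V W : lmodType R) k (f : ('I_k -> V) -> W) v i I (r : seq I)
    (P : pred I) (u : I -> V) : multilinear f ->
  f [eta v with i |-> \sum_(j <- r | P j) u j] = \sum_(j <- r | P j) f [eta v with i |-> u j].
Proof.
move=> mf; elim: r => [|j r IH]; first by rewrite !big_nil multilinear0.
by rewrite !big_cons; case: (P j); rewrite ?multilinearD ?IH.
Qed.

Lemma eta_same (I : eqType) (V : Type) (v : I -> V) i : ([eta v with i |-> v i] : I -> V) = v.
Proof. by apply/funext => j /=; case: eqP => [->|]. Qed.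

(** The right-hand side is multilinear in u as well, so both sides agree as soon
as they do when every u_j is a basis vector.  The induction replaces the
arguments by basis vectors one at a time: at stage m all arguments from the
m-th on are basis vectors. *)
Lemma multilinear_expand (V W : vectType R) k (f : ('I_k -> V) -> W) u :
  multilinear f ->
  f u = \sum_(I : {ffun 'I_k -> 'I_(\dim {:V})})
    (\prod_j vcoord (I j) (u j)) *: f (fun j => (vbasis {:V})`_(I j)).
Proof.
move=> mf; set e := fun i => (vbasis {:V})`_i.
pose S u := \sum_(I : {ffun 'I_k -> 'I_(\dim {:V})})
    (\prod_j vcoord (I j) (u j)) *: f (fun j => (vbasis {:V})`_(I j)).
have mS : multilinear S.
  move=> v i a x y; rewrite /S scaler_sumr -big_split; apply: eq_bigr => I _ /=.
  rewrite scalerA -scalerDl; congr (_ *: _).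
  rewrite !(bigD1 (P := predT) i) //= !eqxx vcoordD vcoordZ mulrDl mulrA.
  by congr (_ + _); congr (_ * _); apply: eq_bigr => j /negPf ->.
suff : forall m, (m <= k)%N -> forall u,
    (forall j : 'I_k, (m <= j)%N -> exists i : 'I_(\dim {:V}), u j = e i) -> f u = S u.
  by apply; [exact: leqnn | move=> j; rewrite leqNgt ltn_ord].
elim=> [_ w|m IH mk w we].
  move=> /(_ _ isT) we; have {we} [I /= we] := choice we.
  have -> : w = fun j => e ([ffun j => I j] j).
    by apply/funext => j; rewrite ffunE we.
  rewrite /S (bigD1 [ffun j => I j]) //= [X in X *: _]big1 ?scale1r; last first.
    by move=> j _; rewrite vcoord_basis ffunE eqxx.
  rewrite big1 ?addr0 // => J JI.
  have [j Jj] : exists j, J j != I j.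
    apply/existsP; rewrite -negb_forall; apply: contra JI => /forallP JI.
    by apply/eqP/ffunP => j; rewrite ffunE; apply/eqP.
  by rewrite (bigD1 j) //= vcoord_basis ffunE (negPf Jj) mul0r scale0r.
pose i0 := Ordinal mk.
rewrite -(eta_same w i0) [w i0]vcoordK (multilinear_sum _ _ _ _ _ mf) (multilinear_sum _ _ _ _ _ mS).
apply: eq_bigr => i _; rewrite (multilinearZ _ _ _ _ mf) (multilinearZ _ _ _ _ mS).
congr (_ *: _); apply: IH; first exact: ltnW.
move=> j; rewrite leq_eqVlt => /orP[/eqP jm|mj] /=.
  by exists i; rewrite (_ : j == i0) //; apply/eqP/val_inj.
by case: eqVneq => [_|_]; [exists i | exact: we].
Qed.

End Multilinear.

Section MultilinearFunctions.
Variables (R : realType) (n : nat) (M : manifold R n).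

Lemma smoothv_multilinear (V W : vectType R) k (f : ('I_k -> V) -> W) (u : 'I_k -> M -> V) :
  multilinear f -> (forall j, smoothv (u j)) -> smoothv (fun y => f (fun j => u j y)).
Proof.
move=> mf su.
rewrite (_ : (fun y => _) = fun y => \sum_(I : {ffun 'I_k -> 'I_(\dim {:V})})
    (\prod_j vcoord (I j) (u j y)) *: f (fun j => (vbasis {:V})`_(I j))).
  apply: smoothv_sum => I _; apply: smoothv_scale; apply: smooth_prod => j _; exact: su.
by apply/funext => y; rewrite {1}multilinear_expand.
Qed.

Lemma vderiv_multilinear (V W : vectType R) k (f : ('I_k -> V) -> W) (u : 'I_k -> M -> V)
    x (v : tangent x) :
  multilinear f -> (forall j, smoothv (u j)) ->
  vderiv v (fun y => f (fun j => u j y)) =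
  \sum_j f [eta (fun j => u j x) with j |-> vderiv v (u j)].
Proof.
move=> mf su.
rewrite (_ : (fun y => _) = fun y => \sum_(I : {ffun 'I_k -> 'I_(\dim {:V})})
    (\prod_j vcoord (I j) (u j y)) *: f (fun j => (vbasis {:V})`_(I j))); last first.
  by apply/funext => y; rewrite {1}multilinear_expand.
have sp (I : {ffun 'I_k -> 'I_(\dim {:V})}) : smooth (fun y => \prod_j vcoord (I j) (u j y)).
  by apply: smooth_prod => j _; exact: su.
rewrite vderiv_sum; last by move=> I _; exact: smoothv_scale.
under [RHS]eq_bigr do rewrite multilinear_expand //.
rewrite [RHS]exchange_big; apply: eq_bigr => I _ /=.
rewrite vderiv_scale // -scaler_suml; congr (_ *: _).
rewrite (der_prod v (index_enum_uniq _) (u := fun j y => vcoord (I j) (u j y))); last first.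
  by move=> j; exact: su.
apply: eq_bigr => j _; rewrite [RHS](bigD1 j) //= eqxx vcoord_vderiv; congr (_ * _).
by apply: eq_bigr => i /negPf ->.
Qed.

End MultilinearFunctions.

(** * The exterior derivative of an alternated form *)

Section AltLift.
Variables (R : realType) (W : lmodType R) (T : Type).

Lemma lift_perm_bij p (r : 'I_p.+1) :
  bijective (fun u : 'I_p.+1 * 'S_p => lift_perm r u.1 u.2).
Proof.
apply: inj_card_bij; last by rewrite card_prod card_ord !card_Sn factS.
move=> [i s] [i' s'] /= e; have /= ei := congr1 (fun t : 'S_p.+1 => t r) e.
rewrite !lift_perm_id in ei; rewrite ei in e *; congr (_, _).
apply/permP => l; have := congr1 (fun t : 'S_p.+1 => t (lift r l)) e.
by rewrite !lift_perm_lift => /lift_inj.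
Qed.

(** A permutation tau of p + 1 letters amounts to the image i of r together with
a permutation of the p remaining letters, and its sign is then the one of the
latter times (-1)^(i + r). *)
Lemma alt_lift p (r : 'I_p.+1) (G : T -> ('I_p -> T) -> W) (v : 'I_p.+1 -> T) :
  \sum_(i < p.+1) (-1) ^+ i *: alt (G (v i)) (fun j => v (lift i j)) =
  (-1) ^+ r *: alt (fun w => G (w r) (fun j => w (lift r j))) v.
Proof.
rewrite {2}/alt (reindex _ (onW_bij _ (lift_perm_bij r))) /= scaler_sumr.
rewrite -(pair_bigA _ (fun i s => (-1) ^+ r *: ((-1) ^+ lift_perm r i s *:
   G (v (lift_perm r i s r)) (fun j => v (lift_perm r i s (lift r j)))))) /=.
apply: eq_bigr => i _; rewrite scaler_sumr; apply: eq_bigr => s _.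
rewrite lift_perm_id odd_lift_perm !scalerA; congr (_ *: G _ _); last first.
  by apply/funext => j; rewrite lift_perm_lift.
by rewrite -addbA signr_addb signr_odd mulrA -expr2 sqrr_sign mul1r signr_addb signr_odd.
Qed.

(** Both sides list the complement of {i, j} in increasing order. *)
Lemma lift_liftC n (i j : 'I_n.+2) (i0 j0 s : _) :
  j = lift i j0 -> i = lift j i0 -> lift i (lift j0 s) = lift j (lift i0 s) :> 'I_n.+2.
Proof.
move=> /(congr1 val) /= ej /(congr1 val) /= ei; apply/val_inj => /=.
move: ei ej; rewrite /bump; move: (i : nat) (j : nat) (i0 : nat) (j0 : nat) (s : nat).
by lia.
Qed.

End AltLift.

Section AlternatedForms.
Variables (R : realType) (n : nat) (M : manifold R n) (W : vectType R).

Definition altf p (F : pform M W p) : pform M W p := fun x v => alt (F x) v.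

(** The Lie derivative for c = 1; for c = 1/2, its antisymmetrization in X and Y
is the exterior derivative ([koszul_altf]).  This is not tensorial in X or Y,
hence its arguments are vector fields. *)
Definition lie_part p c (X : vfield M) (F : pform M W p) (Y : 'I_p -> vfield M) (x : M) : W :=
  vderiv (X x) (fun y => F y (fun j => Y j y))
  - c *: \sum_(l < p) F x (fun j => [eta Y with l |-> vbracket X (Y l)] j x).

Lemma lie_derivE p X (F : pform M W p) Y x : lie_deriv X F Y x = lie_part 1 X F Y x.
Proof. by rewrite /lie_part scale1r. Qed.

Lemma lie_part_altf p c X (F : pform M W p) (Y : 'I_p -> vfield M) x :
  (forall Z : 'I_p -> vfield M, smoothv (fun y => F y (fun j => Z j y))) ->
  lie_part c X (altf F) Y x = alt (fun Z => lie_part c X F Z x) Y.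
Proof.
move=> sF; rewrite /lie_part /altf /alt vderiv_sum; last by move=> s _; exact/smoothvZ/sF.
rewrite [X in c *: X]exchange_big [X in _ - X]scaler_sumr -sumrB; apply: eq_bigr => s _ /=.
rewrite scalerBr vderivZ; last exact: sF; congr (_ - _).
rewrite -scaler_sumr scalerA mulrC -scalerA (reindex_inj (@perm_inj _ s)).
congr (_ *: (_ *: _)); apply: eq_bigr => l _; congr (F x _); apply/funext => j /=.
by rewrite (inj_eq perm_inj); case: eqP.
Qed.

Lemma vbracketC (X Y : vfield M) x : vbracket X Y x = - vbracket Y X x.
Proof.
apply/val_inj/funext => f /=; rewrite /vbracket_fun.
by rewrite -[RHS]/(- (Y x _ - X x _)) opprB.
Qed.

Lemma multilinear_alt (V : lmodType R) p (F : ('I_p -> V) -> W) :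
  multilinear F -> multilinear (alt F).
Proof.
move=> mF v i a u w; rewrite /alt scaler_sumr -big_split; apply: eq_bigr => s _ /=.
have eta_perm (z : V) : (fun j => [eta v with i |-> z] (s j)) =
    [eta (fun j => v (s j)) with (s^-1)%g i |-> z].
  by apply/funext => j /=; rewrite (can2_eq (permK s) (permKV s)).
by rewrite !eta_perm mF scalerDr !scalerA mulrC.
Qed.

(** The Koszul formula runs over the pairs i < j, whereas the antisymmetrization
of the bracket term runs over all pairs i <> j.  Exchanging i and j changes the
sign of the bracket and moves it from one slot to another, with opposite signs:
the terms for (i, j) and (j, i) agree, which explains the factor 1/2.  The slot
r that receives the differentiating vector field is arbitrary, so that it can
be chosen to suit the blocks of F. *)
Lemma koszul_altf p (F : pform M W p) (X : 'I_p.+1 -> vfield M) x (r : 'I_p.+1) :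
  (forall y, multilinear (F y)) ->
  (forall Z : 'I_p -> vfield M, smoothv (fun y => F y (fun j => Z j y))) ->
  koszul (altf F) X x =
  (-1) ^+ r *: alt (fun w => lie_part 2^-1 (w r) F (fun j => w (lift r j)) x) X.
Proof.
move=> mF sF; set phi := altf F.
have mphi : multilinear (phi x) by exact: multilinear_alt.
rewrite -(alt_lift r (fun Z Y => lie_part 2^-1 Z F Y x)).
(* The bracket term of the pair (i, j): [X_i, X_j] replaces X_j in the family
   from which X_i is removed. *)
pose h (i j : 'I_p.+1) := (-1) ^+ i *:
  phi x (fun s => [eta X with j |-> vbracket (X i) (X j)] (lift i s) x).
have lift_eta i l Z s : [eta X with lift i l |-> Z] (lift i s) =
    [eta (fun j => X (lift i j)) with l |-> Z] s.
  by rewrite /= (inj_eq (@lift_inj _ i)).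
have hsym i j : i != j -> h i j = h j i.
  clear r lift_eta; case: p F mF sF X @phi mphi @h i j => [|m] F mF sF X phi mphi h i j ij.
    by rewrite !ord1 eqxx in ij.
  have [j0 ej _] := unlift_some ij.
  have [i0 ei _] : {i0 | i = lift j i0 & unlift j i = Some i0}.
    by apply: unlift_some; rewrite eq_sym.
  have parity : odd j = ~~ (odd i0 (+) odd j0 (+) odd i).
    suff : odd (i0 + j0 + i + j) by rewrite !oddD; do 4!case: (odd _).
    suff -> : (i0 + j0 + i + j = (i0 + j0).*2.+1)%N by rewrite /= odd_double.
    move: ei ej => /(congr1 val) /= + /(congr1 val) /=; rewrite /bump -muln2.
    by move: (i : nat) (j : nat) (i0 : nat) (j0 : nat); lia.
  (* The family of (j, i) is obtained from the one of (i, j) by moving the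
     bracket from slot j0 to slot i0, and changing its sign. *)
  pose u := lift_perm i0 j0 1%g.
  pose Y s := [eta X with j |-> vbracket (X i) (X j)] (lift i s) x.
  have lj t : (lift i t == j) = (t == j0) by rewrite {1}ej (inj_eq (@lift_inj _ i)).
  have li t : (lift j t == i) = (t == i0) by rewrite {1}ei (inj_eq (@lift_inj _ j)).
  have Yi0 : Y (u i0) = vbracket (X i) (X j) x.
    by rewrite /u lift_perm_id /Y /= lj eqxx.
  have -> : h j i = (-1) ^+ j *: phi x [eta (fun s => Y (u s)) with i0 |-> - Y (u i0)].
    congr (_ *: phi x _); apply/funext => s /=; rewrite li.
    case: (unliftP i0 s) => [s'|] ->; last by rewrite eqxx Yi0 vbracketC.
    rewrite eq_sym (negPf (neq_lift _ _)) /Y /u lift_perm_lift perm1 /= lj.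
    by rewrite eq_sym (negPf (neq_lift _ _)) (lift_liftC s' ej ei).
  rewrite multilinearN // (eta_same (fun s => Y (u s))) [phi x _]alt_perm.
  rewrite -scaleNr scalerA -/(phi x Y) /h odd_lift_perm odd_perm1 addbF; congr (_ *: _).
  rewrite -(signr_odd _ i) -(signr_odd _ j) parity.
  by do 3!case: (odd _); rewrite /= ?expr0 ?expr1; ring.
rewrite /koszul; under eq_bigr do rewrite scalerBr.
rewrite sumrB.
have -> : \sum_(i < p.+1) (-1) ^+ i *: (\sum_(l < p | (i <= l)%N)
     phi x (fun j => [eta (fun j => X (lift i j)) with l |->
        vbracket (X i) (X (lift i l))] j x)) =
   2^-1 *: \sum_(i < p.+1) (-1) ^+ i *: (\sum_(l < p)
     phi x (fun j => [eta (fun j => X (lift i j)) with l |->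
        vbracket (X i) (X (lift i l))] j x)).
  have to_h (P : rel nat) (i : 'I_p.+1) : (-1) ^+ i *: (\sum_(l < p | P i (lift i l))
     phi x (fun j => [eta (fun j => X (lift i j)) with l |->
        vbracket (X i) (X (lift i l))] j x)) = \sum_(j | (j != i) && P i j) h i j.
    rewrite -big_lift scaler_sumr; apply: eq_bigr => l _; congr (_ *: phi x _).
    by apply/funext => s; rewrite lift_eta.
  transitivity (\sum_(i < p.+1) \sum_(j < p.+1 | (i < j)%N) h i j).
    apply: eq_bigr => i _; rewrite (eq_bigl (fun j : 'I_p.+1 => (j != i) && (i < j)%N)).
      rewrite -(to_h ltn); congr (_ *: _); apply: eq_bigl => l.
      by rewrite /= /bump; move: (i : nat) (l : nat); lia.
    by move=> j; case: eqVneq => //= ->; rewrite ltnn.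
  transitivity (2^-1 *: \sum_(i < p.+1) \sum_(j < p.+1 | j != i) h i j).
    by rewrite -(sum_sym_pairs hsym) -[X in 2^-1 *: X]scaler_nat scalerA mulVf ?scale1r ?pnatr_eq0.
  congr (_ *: _); apply: eq_bigr => i _; rewrite (to_h (fun _ _ => true)).
  by apply: eq_bigl => j; rewrite andbT.
rewrite scaler_sumr -sumrB; apply: eq_bigr => i _.
rewrite -lie_part_altf // /lie_part scalerBr; congr (_ - _).
by rewrite !scalerA mulrC.
Qed.

End AlternatedForms.
Arguments altf {R n M W p} F x v.

(** * Products of forms over a partition of the arguments *)

Lemma eval_eta (R : realType) n (M : manifold R n) p (Y : 'I_p -> vfield M) l Z (x : M) :
  (fun j => [eta Y with l |-> Z] j x) = [eta (fun j => Y j x) with l |-> Z x].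
Proof. by apply/funext => j /=; case: eqP. Qed.

(* A derivative unfolds to a sum over coordinates, which lemmas on sums should
   not see. *)
Local Opaque vderiv.

Section Blocks.
Variables (R : realType) (n : nat) (M : manifold R n) (V W : vectType R).
Variables (k p : nat) (q : 'I_k -> nat) (s : forall j, 'I_(q j) -> 'I_p) (blk : 'I_p -> 'I_k).
Arguments s : clear implicits.

(** The p arguments are divided into k blocks: [s j b] is the b-th argument of
block j, and [blk] recovers the block of an argument. *)
Definition slot_partition : Prop :=
  [/\ forall j b, blk (s j b) = j, forall j, injective (s j)
    & forall l, exists b, l = s (blk l) b].

Hypothesis part : slot_partition.
Variables (f : ('I_k -> V) -> W) (beta : forall j, pform M V (q j)).
Arguments beta : clear implicits.
Hypothesis mf : multilinear f.

Definition block_product : pform M W p :=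
  fun x v => f (fun j => beta j x (fun b => v (s j b))).

Lemma sum_slots (U : zmodType) (h : 'I_p -> U) :
  \sum_(l < p) h l = \sum_(j < k) \sum_(b < q j) h (s j b).
Proof.
have [sb si sc] := part.
rewrite (partition_big blk predT) //=; apply: eq_bigr => j _.
rewrite (reindex_omap (s j) (fun l => [pick b | s j b == l])); last first.
  move=> l /eqP bl; case: pickP => [b /eqP /= -> //|nb].
  by have := sc l; rewrite bl => -[b lb]; have := nb b; rewrite -lb eqxx.
apply: eq_bigl => b; rewrite sb eqxx /=; case: pickP => [b' /eqP/si ->|/(_ b)]; by rewrite eqxx.
Qed.

Lemma block_product_eta x (v : 'I_p -> tangent x) j b u :
  block_product [eta v with s j b |-> u] =
  f [eta (fun i => beta i x (fun c => v (s i c))) with j |->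
       beta j x [eta (fun c => v (s j c)) with b |-> u]].
Proof.
have [sb si _] := part; congr f; apply/funext => i /=.
case: eqVneq => [->|ij]; congr (beta _ _); apply/funext => c /=; first by rewrite (inj_eq (si j)).
by case: eqVneq => // /(congr1 blk); rewrite !sb => e; rewrite e eqxx in ij.
Qed.

Lemma multilinear_block_product :
  (forall j x, multilinear (beta j x)) -> forall x, multilinear (@block_product x).
Proof.
move=> mb x v l a u w; have [_ _ /(_ l)] := part; move: (blk l) => j [b ->].
by rewrite !block_product_eta mb mf.
Qed.

Lemma smoothv_block_product :
  (forall j (Z : 'I_(q j) -> vfield M), smoothv (fun y => beta j y (fun b => Z b y))) ->
  forall Z : 'I_p -> vfield M, smoothv (fun y => block_product (fun l => Z l y)).
Proof.
move=> sb Z.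
exact: (smoothv_multilinear (u := fun j y => beta j y (fun b => Z (s j b) y))).
Qed.

(** Every argument occurs in exactly one factor, so that both the derivative and
the sum of the bracket terms split over the factors. *)
Lemma lie_part_block_product c X (Y : 'I_p -> vfield M) x :
  (forall j (Z : 'I_(q j) -> vfield M), smoothv (fun y => beta j y (fun b => Z b y))) ->
  lie_part c X block_product Y x =
  \sum_j f [eta (fun i => beta i x (fun b => Y (s i b) x)) with j |->
              lie_part c X (beta j) (fun b => Y (s j b)) x].
Proof.
move=> sb; rewrite /lie_part.
have -> := vderiv_multilinear (X x) mf (fun j => sb j (fun b => Y (s j b))).
rewrite [in LHS]sum_slots [X in _ - X]scaler_sumr -sumrB; apply: eq_bigr => j _.
rewrite (multilinearB _ _ _ _ mf) (multilinearZ _ _ _ _ mf).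
congr (_ - _ *: _); rewrite [RHS](multilinear_sum _ _ _ _ _ mf).
apply: eq_bigr => b _; rewrite eval_eta block_product_eta; congr f.
by apply/funext => i /=; case: eqP => // _; rewrite eval_eta.
Qed.

Lemma is_form_alt_block_product :
  (forall j, is_form (beta j)) -> is_form (altf block_product).
Proof.
move=> fb; have sb j (Z : 'I_(q j) -> vfield M) : smoothv (fun y => beta j y (fun b => Z b y)).
  by have [_ _] := fb j; apply.
split.
- move=> x; apply: multilinear_alt; apply: multilinear_block_product => j y.
  by have [] := fb j.
- by move=> x v i j ij vij; apply: alt_repeat vij.
- move=> X; apply: smoothv_sum => t _; apply: smoothvZ.
  exact: (smoothv_block_product sb (fun i => X (t i))).
Qed.

End Blocks.

Section InvariantBlocks.
Variables (R : realType) (n : nat) (M : manifold R n) (g : lieAlgebra R).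
Variables (zeta : g -> vfield M) (k p : nat) (q : 'I_k -> nat).
Variables (s : forall j, 'I_(q j) -> 'I_p) (blk : 'I_p -> 'I_k).
Arguments s : clear implicits.
Hypothesis part : slot_partition s blk.
Variables (f : ('I_k -> g) -> R^o) (beta : forall j, pform M g (q j)).
Arguments beta : clear implicits.
Hypothesis hf : invariant_multilinear f.

Lemma horizontal_alt_block_product :
  (forall j X (Y : 'I_(q j) -> vfield M) b x, Y b = zeta X -> beta j x (fun b => Y b x) = 0) ->
  horizontal zeta (altf (block_product s f beta)).
Proof.
move=> hb X Y i _ Yi x; have [mf _] := hf; have [_ _ sc] := part.
rewrite /altf /alt big1 // => t _; rewrite /block_product.
have [b eb] := sc (t^-1 i)%g; set j := blk _ in eb.
set u := fun j => _; rewrite -[u](eta_same u j).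
have -> : u j = 0.
  apply: (hb j X (fun b => Y (t (s j b))) b).
  by rewrite -eb permKV.
by rewrite multilinear0 // scaler0.
Qed.

(** By the Leibniz rule and the equivariance of the factors, the Lie derivative
is minus the sum that vanishes by the invariance of f. *)
Lemma lie_deriv_alt_block_product X (Y : 'I_p -> vfield M) x :
  (forall j, equivariant_form zeta (beta j)) ->
  lie_deriv (zeta X) (altf (block_product s f beta)) Y x = 0.
Proof.
move=> eb; have [mf inv] := hf.
have sb j (Z : 'I_(q j) -> vfield M) : smoothv (fun y => beta j y (fun b => Z b y)).
  by have [[_ _ sj] _] := eb j; exact: sj.
rewrite lie_derivE lie_part_altf; last exact: smoothv_block_product.
rewrite -[RHS](alt0 _ Y); apply: eq_alt => Z.
rewrite (lie_part_block_product part) //.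
rewrite -[RHS]oppr0 -[in RHS](inv X (fun j => beta j x (fun b => Z (s j b) x))) -sumrN.
apply: eq_bigr => j _; rewrite -multilinearN //; congr f; apply/funext => i /=.
by case: eqP => // _; rewrite -lie_derivE; have [_ ->] := eb j.
Qed.

Lemma basic_alt_block_product :
  (forall j, equivariant_form zeta (beta j)) ->
  (forall j X (Y : 'I_(q j) -> vfield M) b x, Y b = zeta X -> beta j x (fun b => Y b x) = 0) ->
  basic zeta (altf (block_product s f beta)).
Proof.
move=> eb hb; have [mf _] := hf; split.
- by apply: (is_form_alt_block_product part mf) => j; have [] := eb j.
- exact: horizontal_alt_block_product.
- by move=> X Y x; exact: lie_deriv_alt_block_product.
Qed.

End InvariantBlocks.
Arguments block_product {R n M V W k p q} s f beta x v.

(** * Lie brackets, and forms of degree one and two *)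

Section LieBracket.
Variables (R : realType) (g : lieAlgebra R).
Implicit Types u v w : g.

Lemma lbrDl u v w : lbr (u + v) w = lbr u w + lbr v w.
Proof. by have := lbr_linear_l w 1 u v; rewrite !scale1r. Qed.
Lemma lbrDr u v w : lbr u (v + w) = lbr u v + lbr u w.
Proof. by have := lbr_linear_r u 1 v w; rewrite !scale1r. Qed.
Lemma lbr0l w : lbr 0 w = 0.
Proof. by apply: (@addrI _ (lbr 0 w)); rewrite -lbrDl !addr0. Qed.
Lemma lbr0r w : lbr w 0 = 0.
Proof. by apply: (@addrI _ (lbr w 0)); rewrite -lbrDr !addr0. Qed.
Lemma lbrZl a u w : lbr (a *: u) w = a *: lbr u w.
Proof. by have := lbr_linear_l w a u 0; rewrite lbr0l !addr0. Qed.
Lemma lbrZr a u w : lbr w (a *: u) = a *: lbr w u.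
Proof. by have := lbr_linear_r w a u 0; rewrite lbr0r !addr0. Qed.
Lemma lbrNl u w : lbr (- u) w = - lbr u w.
Proof. by rewrite -[- u]scaleN1r lbrZl scaleN1r. Qed.
Lemma lbrNr u w : lbr w (- u) = - lbr w u.
Proof. by rewrite -[- u]scaleN1r lbrZr scaleN1r. Qed.
Lemma lbrC u w : lbr u w = - lbr w u.
Proof.
apply/eqP; rewrite -addr_eq0; have := lbr_alt (u + w).
by rewrite lbrDl !lbrDr !lbr_alt add0r addr0 => ->.
Qed.

Lemma multilinear_lbr : multilinear (fun u : 'I_2 -> g => lbr (u ord0) (u ord_max)).
Proof.
move=> v i a u w; case: (unliftP ord0 i) => [j|] -> /=.
  by rewrite (ord1 j) /= lbrDr lbrZr.
by rewrite lbrDl lbrZl.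
Qed.

End LieBracket.

Section SmallForms.
Variables (R : realType) (n : nat) (M : manifold R n).

Definition pair2 (T : Type) (a b : T) : 'I_2 -> T := fun i => if i == ord0 then a else b.

Lemma pair2_eta (T : Type) (v : 'I_2 -> T) : v = pair2 (v ord0) (v ord_max).
Proof.
apply/funext => i; rewrite /pair2; case: eqVneq => [->//|i0]; congr v; apply/val_inj.
by case: i i0 => -[|[|]].
Qed.

Lemma fun1E (T : Type) (v : 'I_1 -> T) : v = fun=> v ord0.
Proof. by apply/funext => i; rewrite (ord1 i). Qed.

Lemma eval_pair2 (X Y : vfield M) (x : M) : (fun j => pair2 X Y j x) = pair2 (X x) (Y x).
Proof. by apply/funext => i; rewrite /pair2; case: eqP. Qed.

Lemma vbracket_jacobi (X Y Z : vfield M) x :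
  vbracket (vbracket X Y) Z x + vbracket (vbracket Y Z) X x + vbracket (vbracket Z X) Y x = 0.
Proof.
apply/val_inj/funext => f.
have derB (T T1 T2 : vfield M) h : smooth h ->
    T x (fun y => T1 y (fun z => T2 z h) - T2 y (fun z => T1 z h) : R) =
    T x (fun y => T1 y (fun z => T2 z h)) - T x (fun y => T2 y (fun z => T1 z h)) :> R.
  move=> sh; have sT (U U' : vfield M) : smooth (fun y => U y (fun z => U' z h) : R).
    by do 2!apply: vfield_smooth.
  rewrite -[in RHS]mulN1r [RHS]addrC -der_lin //; congr (T x _).
  by apply/funext => y; rewrite mulN1r addrC.
have [sf|nsf] := pselect (smooth f); last first.
  by have [_ _ /(_ _ nsf)] := asboolW (tangentP
    (vbracket (vbracket X Y) Z x + vbracket (vbracket Y Z) X x + vbracket (vbracket Z X) Y x)).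
rewrite -[LHS]/(vbracket_fun (vbracket X Y) Z x f + vbracket_fun (vbracket Y Z) X x f
   + vbracket_fun (vbracket Z X) Y x f : R) -[RHS]/(0 : R).
rewrite /vbracket_fun /= /vbracket_fun !derB //.
ring.
Qed.

Lemma vbracketNl (X Y Z : vfield M) x :
  vbracket (vbracket X Y) Z x = - vbracket (vbracket Y X) Z x.
Proof.
apply/val_inj/funext => f.
have [sf|nsf] := pselect (smooth f); last first.
  have [_ _ /(_ _ nsf) E1] := asboolW (tangentP (vbracket (vbracket X Y) Z x)).
  have [_ _ /(_ _ nsf) E2] := asboolW (tangentP (- vbracket (vbracket Y X) Z x)).
  by rewrite [LHS]E1 [RHS]E2.
rewrite -[RHS]/(- (vbracket_fun (vbracket Y X) Z x f) : R) /= /vbracket_fun opprB /=.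
have -> : (fun y => vbracket_fun X Y y f) = (fun y => -1 * vbracket_fun Y X y f).
  by apply/funext => y; rewrite mulN1r /vbracket_fun opprB.
rewrite derZ; last exact: (vfield_smooth (vbracket Y X) sf).
by rewrite mulN1r opprK addrC; congr (_ + _); rewrite /vbracket_fun opprB.
Qed.

Variable V : vectType R.

Lemma pformP p (phi psi : pform M V p) : (forall x v, phi x v = psi x v) -> phi = psi.
Proof. by move=> E; apply: functional_extensionality_dep => x; apply/funext. Qed.

Definition eval1 (w : pform M V 1) (X : vfield M) : M -> V := fun y => w y (fun=> X y).

Lemma form1_lin (w : pform M V 1) x a (u v : tangent x) : is_form w ->
  w x (fun=> a *: u + v) = a *: w x (fun=> u) + w x (fun=> v).
Proof.
case=> mw _ _; have := mw x (fun=> 0) ord0 a u v.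
have E (z : tangent x) : [eta (fun=> 0) with ord0 |-> z] = (fun=> z) :> ('I_1 -> tangent x).
  by apply/funext => i; rewrite /= (ord1 i).
by rewrite !E.
Qed.

Lemma form1N (w : pform M V 1) x (u : tangent x) : is_form w ->
  w x (fun=> - u) = - w x (fun=> u).
Proof.
move=> fw; have w0 : w x (fun=> 0) = 0.
  have := form1_lin (-1) (0 : tangent x) 0 fw.
  by rewrite scaler0 addr0 scaleN1r addNr.
by have := form1_lin (-1) u 0 fw; rewrite w0 !addr0 !scaleN1r.
Qed.

Lemma form1D (w : pform M V 1) x (u v : tangent x) : is_form w ->
  w x (fun=> u + v) = w x (fun=> u) + w x (fun=> v).
Proof. by move=> fw; have := form1_lin 1 u v fw; rewrite !scale1r. Qed.

Lemma smoothv_eval1 (w : pform M V 1) X : is_form w -> smoothv (eval1 w X).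
Proof. by case=> _ _ sw; exact: (sw (fun=> X)). Qed.

Lemma koszul1 (w : pform M V 1) (X Y : vfield M) x :
  koszul w (pair2 X Y) x =
  vderiv (X x) (eval1 w Y) - vderiv (Y x) (eval1 w X) - eval1 w (vbracket X Y) x.
Proof.
rewrite /koszul !big_ord_recl !big_ord0 /= addr0 expr0 scale1r.
have -> : bump 0 0 = 1%N by [].
rewrite expr1 scaleN1r.
have -> : (fun y => w y (fun j => pair2 X Y (lift ord0 j) y)) = eval1 w Y by [].
have -> : (fun y => w y (fun j => pair2 X Y (lift (lift ord0 ord0) j) y)) = eval1 w X.
  apply/funext => y; congr (w y _); apply/funext => j; rewrite (ord1 j) /pair2.
  by rewrite (_ : lift _ _ = ord0) //; apply/val_inj.
rewrite !big_mkcond !big_ord_recl !big_ord0 /= !addr0 subr0 addrAC; congr (_ - _ - _).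
by congr (w x _); apply/funext => j; rewrite (ord1 j).
Qed.

Lemma lie_part1 c X (w : pform M V 1) Y x :
  lie_part c X w (fun=> Y) x = vderiv (X x) (eval1 w Y) - c *: eval1 w (vbracket X Y) x.
Proof.
rewrite /lie_part big_ord_recl big_ord0 addr0; congr (_ - _ *: _).
by congr (w x _); apply/funext => j; rewrite (ord1 j).
Qed.

Lemma lie_part2 c X (w : pform M V 2) Y Z x :
  lie_part c X w (pair2 Y Z) x = vderiv (X x) (fun y => w y (pair2 (Y y) (Z y)))
    - c *: (w x (pair2 (vbracket X Y x) (Z x)) + w x (pair2 (Y x) (vbracket X Z x))).
Proof.
rewrite /lie_part !big_ord_recl big_ord0 addr0; congr (vderiv _ _ - _ *: (_ + _)).
- by apply/funext => y; rewrite eval_pair2.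
- by congr (w x _); rewrite [LHS]pair2_eta.
- by congr (w x _); rewrite [LHS]pair2_eta.
Qed.

Lemma is_form_lin p a (phi psi : pform M V p) : is_form phi -> is_form psi ->
  is_form (fun x v => a *: phi x v + psi x v).
Proof.
move=> [m1 a1 s1] [m2 a2 s2]; split=> [x v i b u w|x v i j ij vij|X].
- by rewrite m1 m2 !scalerDr !scalerA mulrC addrACA.
- by rewrite (a1 x v i j) // (a2 x v i j) // scaler0 addr0.
- exact: smoothv_lin (s1 X) (s2 X).
Qed.

Lemma koszul_lin p a (phi psi : pform M V p) X x : is_form phi -> is_form psi ->
  koszul (fun x v => a *: phi x v + psi x v) X x = a *: koszul phi X x + koszul psi X x.
Proof.
move=> [_ _ s1] [_ _ s2]; rewrite /koszul scaler_sumr -big_split; apply: eq_bigr => i _ /=.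
rewrite vderiv_lin; [|exact: s1|exact: s2].
rewrite big_split /= -scaler_sumr.
rewrite !(scalerA, scalerBr, scalerDr) [a * _]mulrC opprD -!addrA; congr (_ + _).
by rewrite addrCA.
Qed.

Lemma is_ext_deriv_lin p a (phi psi : pform M V p) phi' psi' :
  is_form phi -> is_form psi -> is_ext_deriv phi phi' -> is_ext_deriv psi psi' ->
  is_ext_deriv (fun x v => a *: phi x v + psi x v) (fun x v => a *: phi' x v + psi' x v).
Proof.
move=> f1 f2 [f1' d1] [f2' d2]; split; first exact: is_form_lin.
by move=> X x; rewrite koszul_lin // d1 d2.
Qed.

End SmallForms.

(** * Curvature *)

Section Curvature.
Variables (R : realType) (n : nat) (M : manifold R n) (g : lieAlgebra R).

Definition lbr_square (w : pform M g 1) : pform M g 2 :=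
  fun x v => lbr (w x (fun=> v ord0)) (w x (fun=> v ord_max)).

Lemma smoothv_lbr (F G : M -> g) : smoothv F -> smoothv G -> smoothv (fun y => lbr (F y) (G y)).
Proof.
move=> sF sG.
apply: (smoothv_multilinear (u := pair2 F G) (multilinear_lbr (g := g))) => j.
by rewrite /pair2; case: ifP.
Qed.

Lemma vderiv_lbr (F G : M -> g) x (v : tangent x) : smoothv F -> smoothv G ->
  vderiv v (fun y => lbr (F y) (G y)) = lbr (vderiv v F) (G x) + lbr (F x) (vderiv v G).
Proof.
move=> sF sG.
rewrite (vderiv_multilinear (u := pair2 F G) v (multilinear_lbr (g := g))); last first.
  by move=> j; rewrite /pair2; case: ifP.
by rewrite !big_ord_recl big_ord0 addr0.
Qed.

Lemma is_form_lbr_square w : is_form w -> is_form (lbr_square w).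
Proof.
move=> fw; split=> [x v i a u z|x v i j ij vij|X].
- rewrite /lbr_square; case: (unliftP ord0 i) => [j|] -> /=.
    by rewrite (ord1 j) /= form1_lin // lbrDr lbrZr.
  by rewrite form1_lin // lbrDl lbrZl.
- rewrite /lbr_square (_ : v ord0 = v ord_max) ?lbr_alt //.
  rewrite [v]pair2_eta in vij *; rewrite /pair2 in vij *.
  by case: i j ij vij => -[|[|//]] ? [] [|[|//]] ? //= _ ->.
- by apply: smoothv_lbr; exact: smoothv_eval1.
Qed.

Variables (w : pform M g 1) (W : pform M g 2).
Arguments w : clear implicits.
Arguments W : clear implicits.
Hypotheses (fw : is_form w) (curv : is_curvature w W).

Lemma is_form_curvature : is_form W.
Proof.
have [dw [fdw _] ->] := curv; have := is_form_lin 1 fdw (is_form_lbr_square fw).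
by congr is_form; apply: pformP => x v; rewrite scale1r.
Qed.

Lemma curvatureE (X Y : vfield M) x : W x (pair2 (X x) (Y x)) =
  vderiv (X x) (eval1 w Y) - vderiv (Y x) (eval1 w X) - eval1 w (vbracket X Y) x
  + lbr (eval1 w X x) (eval1 w Y x).
Proof. by have [dw [_ ddw] ->] := curv; rewrite -eval_pair2 ddw koszul1. Qed.

Lemma eval1_vbracketC X Y x : eval1 w (vbracket X Y) x = - eval1 w (vbracket Y X) x.
Proof. by rewrite /eval1 vbracketC form1N. Qed.

Lemma eval1_jacobi X Y Z x : eval1 w (vbracket (vbracket X Y) Z) x +
  eval1 w (vbracket (vbracket Y Z) X) x + eval1 w (vbracket (vbracket Z X) Y) x = 0.
Proof.
rewrite /eval1 -!form1D // vbracket_jacobi.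
have := form1_lin (-1) (0 : tangent x) 0 fw.
by rewrite scaler0 addr0 scaleN1r addNr.
Qed.

(** Everything is expressed by second derivatives of omega along vector fields
and by omega on iterated brackets, the form in which the Bianchi identity and
the equivariance of the curvature become linear algebra. *)
Lemma lie_part_curvature c (X Y Z : vfield M) x (D2 := fun X Y Z : vfield M =>
    vderiv (X x) (fun y => vderiv (Y y) (eval1 w Z))) :
  lie_part c X W (pair2 Y Z) x =
  D2 X Y Z - D2 X Z Y - vderiv (X x) (eval1 w (vbracket Y Z))
  + lbr (vderiv (X x) (eval1 w Y)) (eval1 w Z x) + lbr (eval1 w Y x) (vderiv (X x) (eval1 w Z))
  - c *: (D2 X Y Z - D2 Y X Z - vderiv (Z x) (eval1 w (vbracket X Y))
          - eval1 w (vbracket (vbracket X Y) Z) x + lbr (eval1 w (vbracket X Y) x) (eval1 w Z x)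
          + vderiv (Y x) (eval1 w (vbracket X Z)) - (D2 X Z Y - D2 Z X Y)
          + eval1 w (vbracket (vbracket X Z) Y) x + lbr (eval1 w Y x) (eval1 w (vbracket X Z) x)).
Proof.
have sw T := smoothv_eval1 T fw.
rewrite lie_part2; under eq_fun do rewrite curvatureE.
rewrite !curvatureE !vderiv_bracket.
rewrite vderivD; last 2 first.
- by apply: smoothvB => //; apply: smoothvB; exact: smoothv_vderiv.
- exact: smoothv_lbr.
rewrite vderivB //; last by apply: smoothvB; exact: smoothv_vderiv.
rewrite vderivB; try exact: smoothv_vderiv.
rewrite vderiv_lbr // (eval1_vbracketC Y (vbracket X Z)) opprK /D2.
by rewrite !addrA.
Qed.

(** The Bianchi identity dOmega = [Omega, omega]: the cyclic sum on the left is
the Koszul formula for dOmega.  Second derivatives cancel in pairs, the terms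
with two brackets of vector fields by the Jacobi identity of vector fields, and
the terms cubic in omega by the one of g. *)
Lemma bianchi (X Y Z : vfield M) x :
  lie_part 2^-1 X W (pair2 Y Z) x + lie_part 2^-1 Y W (pair2 Z X) x + lie_part 2^-1 Z W (pair2 X Y) x =
  - lbr (eval1 w X x) (W x (pair2 (Y x) (Z x))) - lbr (eval1 w Y x) (W x (pair2 (Z x) (X x)))
  - lbr (eval1 w Z x) (W x (pair2 (X x) (Y x))).
Proof.
have sw T := smoothv_eval1 T fw.
have anti (T S U : vfield M) :
    vderiv (T x) (eval1 w (vbracket S U)) = - vderiv (T x) (eval1 w (vbracket U S)).
  by rewrite -vderivN //; congr (vderiv _ _); apply/funext => y; rewrite eval1_vbracketC.
have anti2 T (S U : vfield M) : eval1 w (vbracket (vbracket S U) T) x =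
    - eval1 w (vbracket (vbracket U S) T) x.
  by rewrite /eval1 -form1N // vbracketNl.
rewrite !lie_part_curvature !curvatureE.
rewrite (anti Y X Z) (anti Z Y X) (anti X Z Y) (anti2 Y X Z) (anti2 Z Y X) (anti2 X Z Y).
rewrite (eval1_vbracketC X Z) (eval1_vbracketC Y X) (eval1_vbracketC Z Y).
rewrite (lbrC (vderiv (X x) (eval1 w Y))) (lbrC (vderiv (Y x) (eval1 w Z))).
rewrite (lbrC (vderiv (Z x) (eval1 w X))).
rewrite (lbrC (eval1 w (vbracket X Y) x)) (lbrC (eval1 w (vbracket Y Z) x)).
rewrite (lbrC (eval1 w (vbracket Z X) x)).
have := lbr_jacobi (eval1 w X x) (eval1 w Y x) (eval1 w Z x); have := eval1_jacobi X Y Z x.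
rewrite !(lbrDr, lbrNr).
move=> Jw Jg; apply: vcoord_inj => i; move: Jw Jg.
move=> /(congr1 (vcoord i)) + /(congr1 (vcoord i)).
rewrite !(vcoordD, vcoordN, vcoordZ, vcoord0).
lra.
Qed.

Lemma curvature_alt (X Y : vfield M) x : W x (pair2 (X x) (Y x)) = - W x (pair2 (Y x) (X x)).
Proof.
rewrite !curvatureE (eval1_vbracketC Y) (lbrC (eval1 w Y x)).
by rewrite !opprD !opprK addrAC [- _ + vderiv _ _]addrC addrAC.
Qed.

Variable zeta : g -> vfield M.

(** With L_A omega = - [A, omega], the derivative of omega(T) along zeta_A is
omega([zeta_A, T]) - [A, omega(T)] for every T; substituting this leaves only
terms that cancel by the two Jacobi identities. *)
Lemma equivariant_curvature : equivariant_form zeta w -> equivariant_form zeta W.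
Proof.
move=> [_ eqw]; split; first exact: is_form_curvature.
have sw T := smoothv_eval1 T fw.
move=> A V x; rewrite [V]pair2_eta; move: (V _) (V _) => Z Y.
have eqw1 (T : vfield M) y : vderiv (zeta A y) (eval1 w T) =
    eval1 w (vbracket (zeta A) T) y - lbr A (eval1 w T y).
  have := eqw A (fun=> T) y; rewrite lie_derivE lie_part1 scale1r => <-.
  by rewrite addrC subrK.
have eqw2 (S T : vfield M) : vderiv (S x) (fun y => vderiv (zeta A y) (eval1 w T)) =
    vderiv (S x) (eval1 w (vbracket (zeta A) T)) - lbr A (vderiv (S x) (eval1 w T)).
  under eq_fun do rewrite eqw1; rewrite vderivB //; last first.
    by apply: (smoothv_lbr (smoothv_cst _)).
  by rewrite (vderiv_lbr _ (smoothv_cst _)) // vderiv_cst lbr0l add0r.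
rewrite lie_derivE lie_part_curvature eval_pair2 !curvatureE !eqw2 !eqw1.
have := eval1_jacobi (zeta A) Y Z x.
rewrite (eval1_vbracketC (zeta A) (vbracket Y Z)).
rewrite /eval1 (vbracketNl Z) form1N // -!/(eval1 w _ x).
have := lbr_jacobi A (eval1 w Y x) (eval1 w Z x).
rewrite (lbrC (eval1 w Z x) A).
rewrite !(lbrDr, lbrDl, lbrNr, lbrNl).
rewrite (lbrC (lbr A (eval1 w Y x))).
move=> Jg Jw; apply: vcoord_inj => i; move: Jw Jg.
move=> /(congr1 (vcoord i)) + /(congr1 (vcoord i)).
rewrite !(vcoordD, vcoordN, vcoordZ, vcoord0).
lra.
Qed.

Lemma connection_reproduces x (A : g) : principal_connection zeta w ->
  free_g_manifold zeta -> w x (fun=> zeta A x) = A.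
Proof. by move=> [_ con] free; apply: (free x); exact: con. Qed.

(** On a free manifold omega(zeta_A) is the constant A.  Hence
domega(zeta_A, Y) = (L_A omega)(Y) = - [A, omega(Y)], which cancels the
quadratic term of the curvature. *)
Lemma curvature_vertical (A : g) (Y : vfield M) x : principal_connection zeta w ->
  free_g_manifold zeta -> W x (pair2 (zeta A x) (Y x)) = 0.
Proof.
move=> con free; have [[_ eqw] _] := con.
have wA : eval1 w (zeta A) = fun=> A.
  by apply/funext => y; exact: connection_reproduces.
have := eqw A (fun=> Y) x; rewrite lie_derivE lie_part1 scale1r => eqwY.
rewrite curvatureE wA vderiv_cst subr0 eqwY -[w x _]/(eval1 w Y x).
by rewrite addNr.
Qed.

End Curvature.
Arguments lbr_square {R n M g} w x v.

(** * Closedness of the Chern-Weil form *)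

Lemma slot_subproof k (j : 'I_k) (b : 'I_2) : (j.*2 + b < k.*2)%N.
Proof. by case: j b => j jk [b b2] /=; rewrite -!muln2; lia. Qed.

(** The pairs 2j, 2j + 1, on which the j-th factor Omega is evaluated. *)
Definition slot k (j : 'I_k) (b : 'I_2) : 'I_(k.*2) := Ordinal (slot_subproof j b).

Lemma slot_block_subproof k (l : 'I_(k.*2)) : (l./2 < k)%N.
Proof. by case: l => l /=; rewrite -muln2; lia. Qed.

Definition slot_block k (l : 'I_(k.*2)) : 'I_k := Ordinal (slot_block_subproof l).

Lemma slotK k (j : 'I_k) b : slot_block (slot j b) = j.
Proof. by apply/val_inj => /=; case: b => b /= b2; rewrite -muln2; lia. Qed.

Lemma slot_surj k (l : 'I_(k.*2)) : exists b, l = slot (slot_block l) b.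
Proof.
have b2 : (odd l < 2)%N by case: (odd l).
by exists (Ordinal b2); apply/val_inj; rewrite /= addnC odd_double_half.
Qed.

Lemma slot_inj k (j : 'I_k) : injective (slot j).
Proof. by move=> b b' /(congr1 val) /= /addnI ?; apply/val_inj. Qed.

Lemma slot_neq k (i j : 'I_k) a b : i != j -> slot i a != slot j b.
Proof. by move=> ij; apply: contraNneq ij => /(congr1 (@slot_block k)); rewrite !slotK => ->. Qed.

Lemma slot01 k (j : 'I_k) : slot j ord0 != slot j ord_max.
Proof. by rewrite (inj_eq (@slot_inj k j)). Qed.

Lemma slot_partition_pairs k : slot_partition (@slot k) (@slot_block k).
Proof. by split; [exact: slotK | exact: slot_inj | exact: slot_surj]. Qed.

Section Closedness.
Variables (R : realType) (n : nat) (M : manifold R n) (g : lieAlgebra R).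
Variables (w : pform M g 1) (W : pform M g 2).
Arguments w : clear implicits.
Arguments W : clear implicits.
Hypotheses (fw : is_form w) (curv : is_curvature w W).

Lemma alt_bianchi p (U : lmodType R) (H : ('I_p -> vfield M) -> g -> U) (a b c : 'I_p) X x :
  a != b -> a != c -> b != c ->
  (forall Y, {morph H Y : e e' / e + e'}) ->
  (forall Y Y', (forall i, i != a -> i != b -> i != c -> Y i = Y' i) -> H Y = H Y') ->
  alt (fun Y => H Y (lie_part 2^-1 (Y a) W (pair2 (Y b) (Y c)) x)) X =
  alt (fun Y => H Y (- lbr (eval1 w (Y a) x) (W x (pair2 (Y b x) (Y c x))))) X.
Proof.
move=> ab ac bc HD Hloc.
apply: (alt_cyclic (E := fun A B C => lie_part 2^-1 A W (pair2 B C) x)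
  (E' := fun A B C => - lbr (eval1 w A x) (W x (pair2 (B x) (C x))))) => // A B C.
exact: bianchi.
Qed.

Variables (k : nat) (f : ('I_k -> g) -> R^o).
Hypothesis hf : forall (A : g) (Y : 'I_k -> g), \sum_(i < k) f [eta Y with i |-> lbr A (Y i)] = 0.
Hypothesis mf : multilinear f.

(** The factor D Omega of block j is replaced by - [omega(X_0), Omega_j]; the sum
over j is then the invariance relation of f for omega(X_0). *)
Lemma koszul_curvature_power (X : 'I_(k.*2).+1 -> vfield M) x :
  koszul (altf (block_product (@slot k) f (fun=> W))) X x = 0.
Proof.
have [mW aW sW] := is_form_curvature fw curv.
have part := slot_partition_pairs k.
rewrite (koszul_altf _ _ ord0); last 2 first.
- exact: (multilinear_block_product part mf).
- exact: smoothv_block_product.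
rewrite expr0 scale1r.
pose u (Y : 'I_(k.*2).+1 -> vfield M) (i : 'I_k) :=
  W x (fun b => Y (lift ord0 (slot i b)) x).
rewrite (@eq_alt _ _ _ _ _ (fun Y => \sum_j f [eta u Y with j |->
    lie_part 2^-1 (Y ord0) W (pair2 (Y (lift ord0 (slot j ord0))) (Y (lift ord0 (slot j ord_max)))) x]));
  last first.
  move=> Y; rewrite (lie_part_block_product part) //; apply: eq_bigr => j _.
  by congr f; apply/funext => i /=; rewrite [X in lie_part _ _ _ X]pair2_eta.
rewrite alt_sum.
rewrite (eq_bigr (fun j => alt (fun Y => - f [eta u Y with j |->
     lbr (eval1 w (Y ord0) x) (u Y j)]) X)); last first.
  move=> j _; rewrite (alt_bianchi (H := fun Y e => f [eta u Y with j |-> e])).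
  - apply: eq_alt => Y; rewrite multilinearN //; congr (- f _); apply/funext => i /=.
    by case: eqP => // _; congr (lbr _ (W x _)); rewrite [RHS]pair2_eta.
  - exact: neq_lift.
  - exact: neq_lift.
  - by rewrite (inj_eq (@lift_inj _ ord0)) slot01.
  - by move=> Y e e'; exact: multilinearD.
  - move=> Y Y' YY'; apply/funext => e; congr f; apply/funext => i /=.
    case: eqVneq => // ij; congr (W x _); apply/funext => b; rewrite YY' //.
    + by rewrite (inj_eq (@lift_inj _ ord0)) slot_neq.
    + by rewrite (inj_eq (@lift_inj _ ord0)) slot_neq.
rewrite -alt_sum -[RHS](alt0 _ X); apply: eq_alt => Y.
by rewrite sumrN hf oppr0.
Qed.

End Closedness.

(** * The transgression form *)

Section Transgression.
Variables (R : realType) (n : nat) (M : manifold R n) (g : lieAlgebra R).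
Variables (w theta : pform M g 1) (W : pform M g 2) (W' : pform M g 2).
Arguments w : clear implicits.
Arguments theta : clear implicits.
Arguments W : clear implicits.
Arguments W' : clear implicits.
Hypotheses (fw : is_form w) (ft : is_form theta) (curv : is_curvature w W).
(* W' is the variation of the curvature W of w along theta. *)
Hypothesis W'E : forall (X Y : vfield M) x, W' x (pair2 (X x) (Y x)) =
  vderiv (X x) (eval1 theta Y) - vderiv (Y x) (eval1 theta X) - eval1 theta (vbracket X Y) x
  + lbr (eval1 w X x) (eval1 theta Y x) - lbr (eval1 w Y x) (eval1 theta X x).
Variables (k : nat) (m : 'I_k.+1) (f : ('I_k.+1 -> g) -> R^o).
Hypothesis hf : forall (A : g) (Y : 'I_k.+1 -> g),
  \sum_(i < k.+1) f [eta Y with i |-> lbr A (Y i)] = 0.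
Hypothesis mf : multilinear f.

Local Notation p := (k.*2.+1).
Local Notation sl j b := (slot j b : 'I_p.+1).
Local Notation r := (sl m ord0).

(** The transgression form has the arguments 0, ..., 2k + 1 except r = 2m: the
factor theta of block m takes the argument 2m + 1.  This maps the index of an
argument other than r to its position among these; the value at r is junk. *)
Definition unskip (i : 'I_p.+1) : 'I_p := odflt ord0 (unlift r i).

Lemma lift_unskip i : i != r -> lift r (unskip i) = i.
Proof. by case: (unliftP r i) => [j -> _|-> /eqP//]; rewrite /unskip liftK. Qed.

(** The factors of the transgression form, which have different degrees: the
boolean tells whether the block is the m-th one, where theta replaces W. *)
Definition tdeg (e : bool) := if e then 1%N else 2%N.

Definition tform (e : bool) : pform M g (tdeg e) :=
  if e return pform M g (tdeg e) then theta else W.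

Arguments tform : clear implicits.

Definition tslot (e : bool) (j : 'I_k.+1) : 'I_(tdeg e) -> 'I_p :=
  if e return 'I_(tdeg e) -> 'I_p then fun=> unskip (sl j ord_max)
  else fun b => unskip (sl j b).

Lemma transgression_partition : slot_partition (fun j => @tslot (j == m) j)
  (fun l => slot_block (lift r l : 'I_(k.+1.*2))).
Proof.
split=> [j|j|l].
- have slr b : j != m -> sl j b != r by exact: slot_neq.
  case: eqVneq slr => [->|jm] slr b; rewrite /= lift_unskip ?slotK //.
    by rewrite eq_sym slot01.
  exact: slr.
- case: eqVneq => [_|jm] b b' /=; first by rewrite (ord1 b) (ord1 b').
  move=> /(congr1 (lift r)) e; apply: (@slot_inj k.+1 j); move: e.
  by rewrite !lift_unskip //; exact: slot_neq.
- have [b eb] := slot_surj (lift r l : 'I_(k.+1.*2)).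
  move: (slot_block _) eb => j eb.
  have Ul : l = unskip (sl j b) by rewrite -eb /unskip liftK.
  case: eqVneq => [jm|_]; last by exists b.
  exists ord0 => /=; rewrite Ul; suff -> : b = ord_max by [].
  apply/val_inj; case: b eb {Ul} => -[|[|//]] //= b0; rewrite jm => /esym e.
  have := neq_lift r l; rewrite -e -val_eqE /=.
  by rewrite eqxx.
Qed.

Definition transgression_form : pform M R^o p :=
  altf (block_product (fun j => @tslot (j == m) j) f (fun j => tform (j == m))).

(** The differentiating vector field is placed in the free argument r = 2m, so
that it forms a block with the argument of theta; as r is even, no sign
appears.  The factors D W become - [w(X_r), W_j] for j <> m, and their sum is
[w(X_r), theta] in block m by invariance of f.  Together with D theta this is
half of the variation W' up to antisymmetrization ([alt_swap]). *)
Lemma koszul_transgression (X : 'I_p.+1 -> vfield M) x :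
  2%:R *: koszul transgression_form X x =
  altf (block_product (@slot k.+1) f (fun j => if j == m then W' else W)) x (fun j => X j x).
Proof.
have [mW aW sW] := is_form_curvature fw curv.
have [mt _ st] := ft.
have part := transgression_partition.
have mb j y : multilinear (tform (j == m) y) by case: (j == m).
have sb (j : 'I_k.+1) (Z : 'I_(tdeg (j == m)) -> vfield M) :
    smoothv (fun y => tform (j == m) y (fun b => Z b y)).
  by case: (j == m) Z => Z; [exact: st | exact: sW].
rewrite (koszul_altf _ _ r); last 2 first.
- exact: (multilinear_block_product part mf).
- exact: smoothv_block_product.
have -> : (-1) ^+ (r : nat) = 1 :> R by rewrite /= addn0 -signr_odd odd_double.
rewrite scale1r.
pose u (Y : 'I_p.+1 -> vfield M) (i : 'I_k.+1) := if i == m then eval1 theta (Y (sl m ord_max)) x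
  else W x (fun b => Y (sl i b) x).
pose e (Y : 'I_p.+1 -> vfield M) (j : 'I_k.+1) :=
  if j == m then lie_part 2^-1 (Y r) theta (fun=> Y (sl m ord_max)) x
  else lie_part 2^-1 (Y r) W (pair2 (Y (sl j ord0)) (Y (sl j ord_max))) x.
rewrite (@eq_alt _ _ _ _ _ (fun Y => \sum_j f [eta u Y with j |-> e Y j])); last first.
  move=> Y; rewrite (lie_part_block_product part) //; apply: eq_bigr => j _.
  have slr (i : 'I_k.+1) b : i != m -> lift r (unskip (sl i b)) = sl i b.
    by move=> im; rewrite lift_unskip ?slot_neq.
  have slm : lift r (unskip (sl m ord_max)) = sl m ord_max.
    by rewrite lift_unskip // eq_sym slot01.
  have -> : (fun i => tform (i == m) x
      (fun b => Y (lift r (@tslot (i == m) i b)) x)) = u Y.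
    apply/funext => i; rewrite /u; case: eqVneq => [->|im] /=; first by rewrite slm.
    by congr (W x _); apply/funext => b; rewrite slr.
  congr f; apply/funext => i /=; case: ifP => // _; rewrite /e; case: eqVneq => [->|jm] /=.
    by rewrite slm.
  by rewrite [X in lie_part _ _ _ X]pair2_eta !slr.
rewrite alt_sum (bigD1 m) //=.
rewrite [X in _ + X](eq_bigr (fun j => alt (fun Y => - f [eta u Y with j |->
     lbr (eval1 w (Y r) x) (u Y j)]) X)); last first.
  move=> j jm; rewrite (@eq_alt _ _ _ _ _ (fun Y => f [eta u Y with j |->
    lie_part 2^-1 (Y r) W (pair2 (Y (sl j ord0)) (Y (sl j ord_max))) x])); last first.
    by move=> Y; rewrite /e (negPf jm).
  rewrite (alt_bianchi fw curv (H := fun Y z => f [eta u Y with j |-> z])).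
  - apply: eq_alt => Y; rewrite multilinearN //; congr (- f _); apply/funext => i /=.
    by case: eqP => // _; rewrite /u (negPf jm); congr (lbr _ (W x _)); rewrite [RHS]pair2_eta.
  - by rewrite slot_neq // eq_sym.
  - by rewrite slot_neq // eq_sym.
  - exact: slot01.
  - by move=> Y z z'; exact: multilinearD.
  - move=> Y Y' YY'; apply/funext => z; congr f; apply/funext => i /=.
    case: eqVneq => // ij; rewrite /u; case: eqVneq => [_|im].
      have mj : m != j by rewrite eq_sym.
      suff -> : Y (sl m ord_max) = Y' (sl m ord_max) by [].
      by apply: YY'; [rewrite eq_sym slot01 | exact: slot_neq | exact: slot_neq].
    by congr (W x _); apply/funext => b; rewrite YY' // slot_neq.
pose Ws (Y : 'I_p.+1 -> vfield M) (i : 'I_k.+1) := W x (fun b => Y (sl i b) x).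
pose E2 (A B : vfield M) := lie_part 2^-1 A theta (fun=> B) x + lbr (eval1 w A x) (eval1 theta B x).
rewrite -alt_sum -altD.
rewrite (@eq_alt _ _ _ _ _ (fun Y => f [eta Ws Y with m |-> E2 (Y r) (Y (sl m ord_max))])); last first.
  move=> Y; have := hf (eval1 w (Y r) x) (u Y); rewrite (bigD1 m) //= => /eqP.
  rewrite addr_eq0 -sumrN => /eqP <-; rewrite -multilinearD //; congr f.
  apply/funext => i /=; rewrite /u /e eqxx; case: eqVneq => // im.
rewrite -(alt_swap (H := fun Y z => f [eta Ws Y with m |-> z])).
- rewrite /altf.
  rewrite -[RHS]/(alt (fun Y : 'I_p.+1 -> vfield M => block_product (@slot k.+1) f
    (fun j => if j == m then W' else W) x (fun j => Y j x)) X).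
  apply: eq_alt => Y; rewrite /block_product; congr f; apply/funext => i /=.
  case: eqVneq => [->|//]; rewrite [X in W' x X]pair2_eta W'E /E2 !lie_part1.
  rewrite /eval1 (vbracketC (Y (sl m ord_max))) form1N // -!/(eval1 _ _ _) scalerN opprK.
  apply: vcoord_inj => c; rewrite !(vcoordD, vcoordN, vcoordZ).
  lra.
- exact: slot01.
- by move=> Y z z'; exact: multilinearB.
- move=> Y Y' YY'; apply/funext => z; congr f; apply/funext => i /=.
  case: eqVneq => // im; congr (W x _); apply/funext => b; rewrite YY' // slot_neq //.
Qed.

End Transgression.
Arguments transgression_form {R n M g} theta W {k} m f x v.

(** * A quadrature formula *)

Section Quadrature.
Variable R : realType.

(** The integral of p' over the unit interval is a combination of the values of p'
at N points as soon as this holds for the monomials 1, ..., x^(N-1), whose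
integrals are 1/(m + 1): the coefficients solve a Vandermonde system. *)
Lemma exact_quadrature N : exists c : 'I_N -> R, forall p : {poly R}, (size p <= N.+1)%N ->
  p.[1] - p.[0] = \sum_(i < N) c i * (deriv p).[i%:R].
Proof.
pose a : 'rV[R]_N := \row_i i%:R; pose V := Vandermonde N a.
have Vu : V \in unitmx.
  rewrite unitmxE unitfE det_Vandermonde; apply/prodf_neq0 => i _.
  apply/prodf_neq0 => j ij; rewrite !mxE subr_eq0 eqr_nat.
  by rewrite gtn_eqF.
pose b : 'cV[R]_N := \col_m (m.+1)%:R^-1; pose c := invmx V *m b.
exists (fun i => c i 0) => p sp.
have cE (m : 'I_N) : \sum_i c i 0 * i%:R ^+ m = (m.+1)%:R^-1.
  have : (V *m c) m 0 = b m 0 by rewrite mulKVmx.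
  by rewrite !mxE => <-; apply: eq_bigr => i _; rewrite !mxE mulrC.
have sd : (size (deriv p) <= N)%N.
  have [->|p0] := eqVneq p 0; first by rewrite deriv0 size_poly0.
  by rewrite -ltnS; apply: leq_trans (lt_size_deriv p0) sp.
transitivity (\sum_(m < N) p`_m.+1).
  rewrite (horner_coef_wide 1 sp) horner_coef0 big_ord_recl expr0 mulr1 addrC addKr.
  by apply: eq_bigr => m _; rewrite expr1n mulr1.
transitivity (\sum_(m < N) \sum_i p`_m.+1 * (m.+1)%:R * (c i 0 * i%:R ^+ m)).
  by apply: eq_bigr => m _; rewrite -mulr_sumr cE mulfK ?pnatr_eq0.
rewrite exchange_big; apply: eq_bigr => i _ /=.
rewrite (horner_coef_wide _ sd) mulr_sumr; apply: eq_bigr => m _.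
by rewrite coef_deriv -mulr_natr; ring.
Qed.

Lemma deriv_prod (I : eqType) (s : seq I) (p : I -> {poly R}) : uniq s ->
  deriv (\prod_(i <- s) p i) = \sum_(i <- s) deriv (p i) * \prod_(j <- s | j != i) p j.
Proof.
elim: s => [_|i s IH /= /andP[is_ us]]; first by rewrite !big_nil derivC.
rewrite big_cons derivM IH // big_cons big_cons eqxx /=; congr (_ + _).
  congr (_ * _); rewrite [RHS]big_seq_cond [LHS]big_seq; apply: eq_bigl => j.
  by case: (boolP (j \in s)) => // js; case: eqVneq js is_ => // -> ->.
rewrite mulr_sumr [LHS]big_seq [RHS]big_seq; apply: eq_bigr => j js.
rewrite big_cons; case: eqVneq js is_ => [-> -> //|_ _ _]; last by rewrite mulrCA.
Qed.

(** f of a family of quadratic curves is a polynomial in the parameter of degree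
at most 2k. *)
Lemma multilinear_path (V : vectType R) k (f : ('I_k -> V) -> R^o) (A B C : 'I_k -> V) :
  multilinear f -> exists2 p : {poly R}, (size p <= k.*2.+1)%N &
    forall t, p.[t] = f (fun j => A j + t *: B j + t ^+ 2 *: C j) /\
      (deriv p).[t] = \sum_m f [eta (fun j => A j + t *: B j + t ^+ 2 *: C j) with m |->
         B m + (t *+ 2) *: C m].
Proof.
move=> mf.
pose h (I : {ffun 'I_k -> 'I_(\dim {:V})}) j : {poly R} :=
  (vcoord (I j) (A j))%:P + vcoord (I j) (B j) *: 'X + vcoord (I j) (C j) *: 'X^2.
have hE I j t : (h I j).[t] = vcoord (I j) (A j + t *: B j + t ^+ 2 *: C j).
  by rewrite /h !(hornerD, hornerC, hornerZ, hornerX, hornerXn) !(vcoordD, vcoordZ); ring.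
have h'E I j t : (deriv (h I j)).[t] = vcoord (I j) (B j + (t *+ 2) *: C j).
  by rewrite /h !poly.derivE !(hornerD, hornerC, hornerZ, hornerX, hornerXn, hornerMn) !(vcoordD, vcoordZ); ring.
have sh I j : (size (h I j) <= 3)%N.
  rewrite /h; apply: leq_trans (size_polyD _ _) _; rewrite geq_max; apply/andP; split.
    apply: leq_trans (size_polyD _ _) _; rewrite geq_max; apply/andP; split.
      exact: leq_trans (size_polyC_leq1 _) _.
    by apply: leq_trans (size_scale_leq _ _) _; rewrite size_polyX.
  by apply: leq_trans (size_scale_leq _ _) _; rewrite size_polyXn.
exists (\sum_(I : {ffun 'I_k -> 'I_(\dim {:V})}) (f (fun j => (vbasis {:V})`_(I j)) : R) *: \prod_j h I j).
  apply: (big_ind (fun p : {poly R} => (size p <= k.*2.+1)%N)).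
  - by rewrite size_poly0.
  - by move=> p q sp sq; apply: leq_trans (size_polyD _ _) _; rewrite geq_max sp.
  - move=> I _; apply: leq_trans (size_scale_leq _ _) _.
    apply: leq_trans (size_prod_leq _ _) _; rewrite card_ord -muln2.
    have : (\sum_(j < k) size (h I j) <= \sum_(j < k) 3)%N by apply: leq_sum.
    by rewrite sum_nat_const card_ord; move: (\sum_(j < k) _)%N => a; lia.
move=> t; split.
  rewrite horner_sum [RHS]multilinear_expand //; apply: eq_bigr => I _.
  rewrite hornerZ horner_prod mulrC; congr (_ * _); apply: eq_bigr => j _; exact: hE.
under [RHS]eq_bigr do rewrite multilinear_expand //.
rewrite raddf_sum horner_sum [RHS]exchange_big; apply: eq_bigr => I _ /=.
rewrite derivZ hornerZ -scaler_suml mulrC; congr (_ * _).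
rewrite (deriv_prod _ (index_enum_uniq _)) horner_sum; apply: eq_bigr => j _.
rewrite hornerM h'E [RHS](bigD1 j) //= eqxx; congr (_ * _).
by rewrite horner_prod; apply: eq_bigr => i /negPf ->; exact: hE.
Qed.

Lemma multilinear_homotopy k : exists c : 'I_(k.*2) -> R,
  forall (V : vectType R) (f : ('I_k -> V) -> R^o) (A B C : 'I_k -> V), multilinear f ->
  f (fun j => A j + B j + C j) - f A =
  \sum_(i < k.*2) c i *: \sum_m f [eta (fun j => A j + i%:R *: B j + i%:R ^+ 2 *: C j)
     with m |-> B m + (i%:R *+ 2) *: C m].
Proof.
have [c cP] := exact_quadrature k.*2; exists c => V f A B C mf.
have [p sp pE] := multilinear_path A B C mf.
have := cP p sp; have [-> _] := pE 1; have [-> _] := pE 0.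
have -> : (fun j => A j + 1 *: B j + 1 ^+ 2 *: C j) = (fun j => A j + B j + C j).
  by apply/funext => j; rewrite expr1n !scale1r.
have -> : (fun j => A j + 0 *: B j + 0 ^+ 2 *: C j) = A.
  by apply/funext => j; rewrite expr0n /= !scale0r !addr0.
by move=> ->; apply: eq_bigr => i _; have [_ ->] := pE i%:R.
Qed.

End Quadrature.

(** * The Chern-Weil form as an alternation *)

Section ChernWeilAlt.
Variables (R : realType) (n : nat) (M : manifold R n) (g : lieAlgebra R).
Variables (W : pform M g 2).
Arguments W : clear implicits.

(** The inner alternation over the last 2k arguments, extended to permutations of
all 2k + 2 arguments, is absorbed by the outer one; each of its (2k)! terms
contributes the same, which cancels one factorial of the wedge product.  The
other one is the 2! of Omega and gives the power of 1/2. *)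
Lemma wedge_powerE k x v (I : {ffun 'I_k -> 'I_(\dim {:g})}) :
  wedge_power W v I = 2^-1 ^+ k *
   alt (fun v => \prod_j vcoord (I j) (W x (fun b => v (slot j b))) : R^o) v.
Proof.
elim: k v I => [|k IH] v I.
  rewrite /= ffunE expr0 mul1r /alt (bigD1 1%g) //= [X in _ + X]big1 ?addr0; last first.
    by move=> s /eqP[]; exact: permS0.
  by rewrite odd_perm1 expr0 scale1r big_ord0.
pose G (v : 'I_(k.+1.*2) -> tangent x) : R^o :=
  \prod_j vcoord (I j) (W x (fun b => v (slot j b))).
pose I' := [ffun j => I (lift ord0 j)].
(* The permutation u of the last 2k arguments, fixing the first two. *)
pose U (u : 'S_(k.*2)) : 'S_(k.*2.+2) := lift_perm ord0 ord0 (lift_perm ord0 ord0 u).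
have oddU u : odd_perm (U u) = odd_perm u by rewrite !odd_lift_perm.
have rshiftE (i : 'I_(k.*2)) : rshift 2 i = lift ord0 (lift ord0 i) by apply/val_inj.
have UE (s : 'S_(2 + k.*2)) (u : 'S_(k.*2)) : G (fun i => v (s (U u i))) =
   vcoord (I ord0) (W x (fun b => v (s (lshift _ b)))) *
   \prod_j vcoord (I' j) (W x (fun b => v (s (rshift 2 (u (slot j b)))))).
  rewrite /G big_ord_recl; congr (vcoord _ (W x _) * _).
    apply/funext => b; congr (v (s _)).
    have -> : slot ord0 b = lshift (k.*2) b :> 'I_(k.*2.+2) by apply/val_inj.
    case: (unliftP ord0 b) => [c|] ->.
      have -> : lshift (k.*2) (lift ord0 c) = lift ord0 ord0 :> 'I_(k.*2.+2).
        by apply/val_inj; rewrite /= (ord1 c).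
      by rewrite /U !(lift_perm_lift, lift_perm_id).
    have -> : lshift (k.*2) (ord0 : 'I_2) = ord0 :> 'I_(k.*2.+2) by apply/val_inj.
    by rewrite /U lift_perm_id.
  apply: eq_bigr => j _; rewrite ffunE; congr (vcoord _ (W x _)).
  apply/funext => b; congr (v (s _)); rewrite rshiftE.
  have -> : slot (lift ord0 j) b = lift ord0 (lift ord0 (slot j b)) :> 'I_(k.*2.+2).
    by apply/val_inj; rewrite /= /bump /= -!muln2; lia.
  by rewrite /U !lift_perm_lift.
rewrite /= /wedge ffunE sum_ffunE.

transitivity ((2`! * (k.*2)`!)%:R^-1 * \sum_(s : 'S_(2 + k.*2)) (-1) ^+ s *
   (2^-1 ^+ k * \sum_(u : 'S_(k.*2)) (-1) ^+ u * G (fun i => v (s (U u i))))).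
  congr (_ * _); apply: eq_bigr => s _; rewrite !ffunE IH mulrCA mulr_sumr.
  congr (_ * (_ * _)).
  by apply: eq_bigr => u _; rewrite UE mulrCA.
have -> : \sum_(s : 'S_(2 + k.*2)) (-1) ^+ s *
   (2^-1 ^+ k * \sum_(u : 'S_(k.*2)) (-1) ^+ u * G (fun i => v (s (U u i)))) =
   2^-1 ^+ k * \sum_(u : 'S_(k.*2)) (-1) ^+ u * alt (fun w => G (fun i => w (U u i))) v.
  rewrite mulr_sumr; under eq_bigr do rewrite mulrCA mulr_sumr mulr_sumr.
  rewrite exchange_big; apply: eq_bigr => u _; rewrite /alt !mulr_sumr.
  by apply: eq_bigr => s _; congr (_ * _); rewrite mulrCA.
under eq_bigr => u _ do rewrite alt_reindex oddU -[_ *: _]/(_ * _) mulrA -expr2 sqrr_sign mul1r.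
rewrite sumr_const card_Sn -mulr_natl exprS natrM.
have f0 : (k.*2)`!%:R != 0 :> R by rewrite pnatr_eq0 -lt0n fact_gt0.
have -> : 2`!%:R = 2 :> R by [].
by field.
Qed.

Lemma chern_weilE k (f : ('I_k -> g) -> R^o) : multilinear f ->
  chern_weil f W = fun x v => 2^-1 ^+ k *: altf (block_product (@slot k) f (fun=> W)) x v.
Proof.
move=> mf; apply: pformP => x v; rewrite /chern_weil /tensor_apply.
transitivity (\sum_(I : {ffun 'I_k -> 'I_(\dim {:g})}) (2^-1 ^+ k * alt
  (fun v => \prod_j vcoord (I j) (W x (fun b => v (slot j b))) : R^o) v)
   *: f (fun j => (vbasis {:g})`_(I j))).
  by apply: eq_bigr => I _; rewrite wedge_powerE.
under eq_bigr do rewrite -scalerA.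
rewrite -scaler_sumr; congr (_ *: _); rewrite /altf /alt.
under eq_bigr do rewrite scaler_suml.
rewrite exchange_big; apply: eq_bigr => s _ /=.
rewrite /block_product multilinear_expand // scaler_sumr; apply: eq_bigr => I _.
by rewrite scalerA.
Qed.

End ChernWeilAlt.

(** * Exactness in a linear class of forms *)

Section LinearClasses.
Variables (R : realType) (n : nat) (M : manifold R n).

Lemma is_form0 (V : vectType R) p : is_form (@pform0 R n M V p).
Proof.
split=> [x v i a u w|//|X i]; first by rewrite /pform0 scaler0 addr0.
exact: (smoothv_cst (0 : V)).
Qed.

Lemma koszul0 (V : vectType R) p X x : koszul (@pform0 R n M V p) X x = 0.
Proof.
rewrite /koszul big1 // => i _; rewrite /pform0 vderiv_cst big1 // subr0.
by rewrite scaler0.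
Qed.

Lemma koszulZ (V : vectType R) p a (phi : pform M V p) X x : is_form phi ->
  koszul (fun x v => a *: phi x v) X x = a *: koszul phi X x.
Proof.
move=> fphi; have := koszul_lin a X x fphi (is_form0 V p).
by rewrite koszul0 addr0 => <-; congr koszul; apply: pformP => y v; rewrite addr0.
Qed.

(** Covers the two complexes of interest, all forms and the basic forms. *)
Definition linear_class (C : forall p, pform M R^o p -> Prop) : Prop :=
  [/\ forall p (phi : pform M R^o p), C p phi -> is_form phi,
      forall p, C p (@pform0 R n M R^o p)
    & forall p a (phi psi : pform M R^o p), C p phi -> C p psi ->
        C p (fun x v => a *: phi x v + psi x v)].

Variable C : forall p, pform M R^o p -> Prop.
Hypothesis linC : linear_class C.

Lemma linear_classZ p a (phi : pform M R^o p) : C phi -> C (fun x v => a *: phi x v).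
Proof.
have [_ C0 Cl] := linC => Cphi; have := Cl p a _ _ Cphi (C0 p).
by congr C; apply: pformP => x v; rewrite addr0.
Qed.

Lemma exact_in_sum q I (r : seq I) (a : I -> R) (eta : I -> pform M R^o q.+1) :
  (forall i, @exact_in _ _ _ C q.+1 (eta i)) ->
  @exact_in _ _ _ C q.+1 (fun x v => \sum_(i <- r) a i *: eta i x v).
Proof.
have [Cf C0 Cl] := linC => ex; elim: r => [|i r [psi [Cpsi dpsi]]].
  exists (@pform0 R n M R^o q); split; first exact: C0.
  rewrite (_ : (fun x v => _) = @pform0 R n M R^o q.+1).
    by split; [exact: is_form0 | move=> X x; rewrite koszul0].
  by apply: pformP => x v; rewrite big_nil.
have [phi [Cphi dphi]] := ex i.
exists (fun x v => a i *: phi x v + psi x v); split; first exact: Cl.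
rewrite (_ : (fun x v => _) = fun x v => a i *: eta i x v + \sum_(j <- r) a j *: eta j x v).
  by apply: is_ext_deriv_lin => //; exact: Cf.
by apply: pformP => x v; rewrite big_cons.
Qed.

End LinearClasses.

(** * Dependence on the connection *)

Section ChernWeil.
Variables (R : realType) (n : nat) (M : manifold R n) (g : lieAlgebra R).

Lemma is_form_chern_weil (W : pform M g 2) k (f : ('I_k -> g) -> R^o) :
  multilinear f -> is_form W -> is_form (chern_weil f W).
Proof.
move=> mf fW; rewrite chern_weilE //.
have linF : linear_class (fun p => @is_form R n M R^o p).
  by split=> // [p|p a phi psi]; [exact: is_form0 | exact: is_form_lin].
have fF := is_form_alt_block_product (slot_partition_pairs k) mf (fun=> fW).
exact: (linear_classZ linF _ fF).
Qed.

Lemma chern_weil_closed (w : pform M g 1) (W : pform M g 2) k (f : ('I_k -> g) -> R^o) :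
  invariant_multilinear f -> is_form w -> is_curvature w W ->
  is_ext_deriv (chern_weil f W) (@pform0 R n M R^o (k.*2).+1).
Proof.
move=> [mf hf] fw curv; split=> [|X x]; first exact: is_form0.
rewrite chern_weilE // koszulZ; last first.
  apply: (is_form_alt_block_product (slot_partition_pairs k)) => // _.
  exact: is_form_curvature curv.
by rewrite (koszul_curvature_power fw curv hf mf) scaler0.
Qed.

Section Path.
Variables (wa wb : pform M g 1) (Wa Wb : pform M g 2).
Arguments wa : clear implicits.
Arguments wb : clear implicits.
Arguments Wa : clear implicits.
Arguments Wb : clear implicits.
Hypotheses (fa : is_form wa) (fb : is_form wb).
Hypotheses (ca : is_curvature wa Wa) (cb : is_curvature wb Wb).

Definition conn_diff : pform M g 1 := fun x v => -1 *: wa x v + wb x v.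

Arguments conn_diff : clear implicits.

Definition conn_path (t : R) : pform M g 1 := fun x v => t *: conn_diff x v + wa x v.

(** The curvature of [conn_path t] is quadratic in t, with this linear
coefficient: Wb - Wa minus the quadratic coefficient [theta, theta], as the
value at t = 1 has to be Wb. *)
Definition curv_lin : pform M g 2 :=
  fun x v => -1 *: (1 *: Wa x v + lbr_square conn_diff x v) + Wb x v.

Arguments curv_lin : clear implicits.

Definition curv_path (t : R) : pform M g 2 :=
  fun x v => Wa x v + t *: curv_lin x v + t ^+ 2 *: lbr_square conn_diff x v.

Definition curv_speed (t : R) : pform M g 2 :=
  fun x v => curv_lin x v + (t *+ 2) *: lbr_square conn_diff x v.

Arguments curv_speed : clear implicits.

Lemma is_form_conn_diff : is_form conn_diff. Proof. exact: is_form_lin. Qed.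

Lemma is_form_conn_path t : is_form (conn_path t).
Proof. by apply: is_form_lin => //; exact: is_form_conn_diff. Qed.

Lemma is_form_curv_speed t : is_form (curv_speed t).
Proof.
have fS := is_form_lbr_square is_form_conn_diff.
have fWa := is_form_curvature fa ca; have fWb := is_form_curvature fb cb.
have fL : is_form curv_lin by apply: is_form_lin => //; exact: is_form_lin.
have := is_form_lin (t *+ 2) fS fL.
by congr is_form; apply: pformP => x v; rewrite addrC.
Qed.

Lemma curv_path_end x v : Wa x v + curv_lin x v + lbr_square conn_diff x v = Wb x v.
Proof. by rewrite /curv_lin scale1r scaleN1r opprD addrA addrA subrr sub0r addrAC addNr add0r. Qed.

Lemma is_curvature_path t : is_curvature (conn_path t) (curv_path t).
Proof.
have [da dda Ea] := ca; have [db ddb Eb] := cb.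
exists (fun x v => t *: (-1 *: da x v + db x v) + da x v).
  apply: is_ext_deriv_lin => //; first exact: is_form_lin.
  exact: is_ext_deriv_lin.
apply: pformP => x v; rewrite /curv_path /curv_lin Ea Eb /lbr_square /conn_path /conn_diff.
apply: vcoord_inj => c; rewrite !(lbrDl, lbrDr, lbrZl, lbrZr).
rewrite !(vcoordD, vcoordZ, vcoordN).
ring.
Qed.

Lemma curv_speedE t (X Y : vfield M) x : curv_speed t x (pair2 (X x) (Y x)) =
  vderiv (X x) (eval1 conn_diff Y) - vderiv (Y x) (eval1 conn_diff X)
  - eval1 conn_diff (vbracket X Y) x
  + lbr (eval1 (conn_path t) X x) (eval1 conn_diff Y x)
  - lbr (eval1 (conn_path t) Y x) (eval1 conn_diff X x).
Proof.
have dE (S T : vfield M) : vderiv (S x) (eval1 conn_diff T) =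
    -1 *: vderiv (S x) (eval1 wa T) + vderiv (S x) (eval1 wb T).
  by rewrite -vderiv_lin //; exact: smoothv_eval1.
rewrite !dE /curv_speed /curv_lin (curvatureE ca) (curvatureE cb).
rewrite /lbr_square /conn_path /conn_diff /eval1 /=.
rewrite (lbrC (t *: (-1 *: wa x (fun=> Y x) + wb x (fun=> Y x)) + wa x (fun=> Y x))).
apply: vcoord_inj => c; rewrite !(lbrDl, lbrDr, lbrZl, lbrZr).
rewrite !(vcoordD, vcoordZ, vcoordN).
ring.
Qed.

(** d/dt of f^W_t is exact for every t with a primitive in the class C, and the
quadrature formula expresses the difference of the end points by finitely many
values of t. *)
Lemma transgression (C : forall p, pform M R^o p -> Prop) k (f : ('I_k.+1 -> g) -> R^o) :
  linear_class C -> invariant_multilinear f ->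
  (forall (m : 'I_k.+1) t, C _ (transgression_form conn_diff (curv_path t) m f)) ->
  exact_in C (pform_sub (chern_weil f Wb) (chern_weil f Wa)).
Proof.
move=> linC [mf hf] CQ.
have [c cP] := multilinear_homotopy R k.+1.
pose T (i : R) (m : 'I_k.+1) : pform M R^o (k.*2).+2 :=
  altf (block_product (@slot k.+1) f (fun j => if j == m then curv_speed i else curv_path i)).
have exT t m : @exact_in _ _ _ C (k.*2).+2 (T t m).
  have fS := is_form_curv_speed t; have fP := is_form_conn_path t.
  have fW := is_form_curvature fP (is_curvature_path t).
  exists (fun x v => 2%:R *: transgression_form conn_diff (curv_path t) m f x v); split.
    by exact: (linear_classZ linC _ (CQ m t)).
  split.
    apply: (is_form_alt_block_product (slot_partition_pairs k.+1)) => // j.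
    by case: ifP.
  move=> X x; rewrite koszulZ; last by have [Cf _ _] := linC; apply: Cf; apply: CQ.
  exact/esym/(koszul_transgression fP is_form_conn_diff (is_curvature_path t)
     (curv_speedE t) m hf mf).
have := exact_in_sum linC (index_enum _) (fun i => 2^-1 ^+ k.+1 * c i)
  (fun i : 'I_(k.+1.*2) => exact_in_sum linC (index_enum _) (fun=> 1) (exT i%:R)).
congr exact_in; apply: pformP => x v; rewrite /pform_sub !chern_weilE //.
rewrite -scalerBr; under eq_bigr do rewrite -scalerA.
rewrite -scaler_sumr; congr (_ *: _); rewrite /T /altf /alt.
under eq_bigr => i _.
  under eq_bigr do rewrite scale1r.
  rewrite exchange_big scaler_sumr; over.
rewrite exchange_big -sumrB; apply: eq_bigr => s _ /=.
rewrite -scalerBr; under eq_bigr do rewrite -scaler_sumr scalerA mulrC -scalerA.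
rewrite -scaler_sumr; congr (_ *: _); rewrite /block_product.
pose u (F : pform M g 2) (j : 'I_k.+1) := F x (fun b => v (s (slot j b))).
have := cP g f (u Wa) (u curv_lin) (u (lbr_square conn_diff)) mf.
have -> : (fun j => u Wa j + u curv_lin j + u (lbr_square conn_diff) j) = u Wb.
  by apply/funext => j; rewrite /u curv_path_end.
move=> ->; apply: eq_bigr => i _; congr (_ *: _); apply: eq_bigr => m _; congr f.
by apply/funext => j /=; case: eqP => [->|_].
Qed.

End Path.

Variable zeta : g -> vfield M.

Lemma lie_deriv_lin (V : vectType R) p a (phi psi : pform M V p) X Y x :
  is_form phi -> is_form psi ->
  lie_deriv X (fun x v => a *: phi x v + psi x v) Y x =
  a *: lie_deriv X phi Y x + lie_deriv X psi Y x.
Proof.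
move=> [_ _ s1] [_ _ s2]; rewrite /lie_deriv vderiv_lin; [|exact: s1|exact: s2].
by rewrite big_split /= -scaler_sumr scalerBr opprD addrACA.
Qed.

Lemma equivariant_form_lin p a (phi psi : pform M g p) :
  equivariant_form zeta phi -> equivariant_form zeta psi ->
  equivariant_form zeta (fun x v => a *: phi x v + psi x v).
Proof.
move=> [f1 e1] [f2 e2]; split; first exact: is_form_lin.
by move=> X Y x; rewrite lie_deriv_lin // e1 e2 lbrDr lbrZr scalerN opprD.
Qed.

Lemma linear_class_form : linear_class (fun p => @is_form R n M R^o p).
Proof. by split=> // [p|p a phi psi]; [exact: is_form0 | exact: is_form_lin]. Qed.

Lemma linear_class_basic : linear_class (@basic R n M g zeta).
Proof.
split=> [p phi [] //|p|p a phi psi [f1 h1 l1] [f2 h2 l2]]; split.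
- exact: is_form0.
- by [].
- by move=> X Y x; rewrite /lie_deriv /pform0 vderiv_cst big1 // subr0.
- exact: is_form_lin.
- by move=> X Y i i0 Yi x; rewrite (h1 X Y i) // (h2 X Y i) // scaler0 addr0.
- by move=> X Y x; rewrite lie_deriv_lin // l1 l2 scaler0 addr0.
Qed.

Lemma principal_connection_path (wa wb : pform M g 1) t : g_manifold zeta ->
  principal_connection zeta wa -> principal_connection zeta wb ->
  principal_connection zeta (conn_path wa wb t).
Proof.
move=> [zlin _] [ea za] [eb zb]; split.
  by apply: equivariant_form_lin => //; exact: equivariant_form_lin.
move=> x X; rewrite /conn_path /conn_diff !zlin za zb.
by rewrite scaleN1r addNr scaler0 add0r.
Qed.

Lemma curvature_vertical_slot (w : pform M g 1) (W : pform M g 2) A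
    (Y : 'I_2 -> vfield M) b x :
  principal_connection zeta w -> is_curvature w W -> free_g_manifold zeta ->
  Y b = zeta A -> W x (fun c => Y c x) = 0.
Proof.
move=> con curv free; have [[fw _] _] := con.
rewrite (_ : (fun c => Y c x) = pair2 (Y ord0 x) (Y ord_max x)); last by rewrite [LHS]pair2_eta.
case: (unliftP ord0 b) => [c|] -> YA.
  have := YA; rewrite (_ : lift ord0 c = ord_max); last by apply/val_inj; rewrite /= (ord1 c).
  by move=> ->; rewrite (curvature_alt fw curv) (curvature_vertical curv A _ x con free) oppr0.
by rewrite YA (curvature_vertical curv A _ x con free).
Qed.

Lemma basic_chern_weil (w : pform M g 1) (W : pform M g 2) k (f : ('I_k -> g) -> R^o) :
  invariant_multilinear f -> principal_connection zeta w -> is_curvature w W ->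
  free_g_manifold zeta -> basic zeta (chern_weil f W).
Proof.
move=> hf con curv free; have [mf _] := hf; have [ew _] := con; have [fw _] := ew.
rewrite chern_weilE //.
have bF : basic zeta (altf (block_product (@slot k) f (fun=> W))).
  apply: (basic_alt_block_product (slot_partition_pairs k) hf) => [_|_ X Y b x YX].
    exact: (equivariant_curvature fw curv ew).
  exact: (curvature_vertical_slot x con curv free YX).
exact: (linear_classZ linear_class_basic _ bF).
Qed.

End ChernWeil.

(** * Chern-Weil classes *)

Theorem proposition7p5 (R : realType) (n : nat) (M : manifold R n)
    (g : lieAlgebra R) (zeta : g -> vfield M) (hzeta : g_manifold zeta)
    (omega0 omega1 : pform M g 1)
    (homega0 : principal_connection zeta omega0)
    (homega1 : principal_connection zeta omega1)
    (Omega0 Omega1 : pform M g 2)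
    (hOmega0 : is_curvature omega0 Omega0)
    (hOmega1 : is_curvature omega1 Omega1)
    (k : nat) (f : ('I_k -> g) -> R^o) (hf : invariant_multilinear f) :
  [/\ equivariant_form zeta Omega0,
      equivariant_form zeta Omega1
    & same_class (fun p => @is_form R n M R^o p)
        (chern_weil f Omega0) (chern_weil f Omega1)] /\
  (free_g_manifold zeta ->
    [/\ horizontal zeta Omega0,
        horizontal zeta Omega1
      & same_class (basic zeta) (chern_weil f Omega0) (chern_weil f Omega1)]).
Proof.
have [mf _] := hf; have [e0 _] := homega0; have [e1 _] := homega1.
have [f0 _] := e0; have [f1 _] := e1.
(* The segment runs from omega1 to omega0, since the difference of the classes
   is taken in this order. *)
have fP := is_form_conn_path f1 f0; have cP := is_curvature_path f1 f0 hOmega1 hOmega0.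
have fD := is_form_conn_diff f1 f0.
have fW (t : R) := is_form_curvature (fP t) (cP t).
have exact_class (C : forall p, pform M R^o p -> Prop) : linear_class C ->
    (forall l (h : ('I_l.+1 -> g) -> R^o) (m : 'I_l.+1) t, invariant_multilinear h ->
      C _ (transgression_form (conn_diff omega1 omega0)
             (curv_path omega1 omega0 Omega1 Omega0 t) m h)) ->
    exact_in C (pform_sub (chern_weil f Omega0) (chern_weil f Omega1)).
  move=> linC CQ; case: k f hf {mf} => [|l] h hh.
  (* In degree 0 both forms are the same constant. *)
    by apply: pformP => x v; rewrite /pform_sub subrr.
  by apply: (transgression f1 f0) => // m t; exact: CQ.
have cl0 := chern_weil_closed hf f0 hOmega0; have cl1 := chern_weil_closed hf f1 hOmega1.
split=> [|free].
  split; [exact: (equivariant_curvature f0 hOmega0 e0)|exact: (equivariant_curvature f1 hOmega1 e1)|].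
  split.
  - by split=> //; apply: is_form_chern_weil => //; exact: is_form_curvature hOmega0.
  - by split=> //; apply: is_form_chern_weil => //; exact: is_form_curvature hOmega1.
  - apply: exact_class => [|l h m t [mh _]]; first exact: linear_class_form.
    apply: (is_form_alt_block_product (transgression_partition m) mh) => j.
    by case: (j == m); [exact: fD | exact: fW].
split; [| |split].
- by move=> A Y i _ Yi x; exact: (curvature_vertical_slot x homega0 hOmega0 free Yi).
- by move=> A Y i _ Yi x; exact: (curvature_vertical_slot x homega1 hOmega1 free Yi).
- by split=> //; exact: basic_chern_weil homega0 hOmega0 free.
- by split=> //; exact: basic_chern_weil homega1 hOmega1 free.
apply: exact_class => [|l h m t hh]; first exact: linear_class_basic.
have conP := principal_connection_path t hzeta homega1 homega0.
apply: (basic_alt_block_product (transgression_partition m) hh) => [j|j].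
  case: (j == m) => /=; first exact: equivariant_form_lin.
  by apply: (equivariant_curvature (fP t) (cP t)); have [] := conP.
case: (j == m) => /= A Y b x YA; last exact: (curvature_vertical_slot x conP (cP t) free YA).
rewrite (ord1 b : b = ord0) in YA; rewrite /conn_diff (fun1E (fun c => Y c x)) YA.
rewrite (connection_reproduces _ _ homega0) // (connection_reproduces _ _ homega1) //.
by rewrite scaleN1r addNr.
Qed.
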